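(* Let $R$ be a commutative artin ring, $\mathcal{C}$ a dualizing $R$-variety, $P=\mathrm{Hom}_{\mathcal{C}}(C,-)\in\mathrm{mod}(\mathcal{C})$ and $\mathcal{I}=\mathrm{Tr}_{P}\mathcal{C}$. The following are equivalent. (a) $\mathcal{I}$ is $2$-idempotent and $\mathbb{I}_{1}=\mathbb{I}_{\infty}$. (b) $\mathcal{I}(C',-)$ is a projective $\mathcal{C}$-module for all $C'\in\mathcal{C}$.
   Context: A Hom-finite $R$-variety is a small additive category in which idempotents split, whose Hom-sets are finitely generated $R$-modules with $R$-bilinear composition. $\mathrm{Mod}(\mathcal{C})$ is the category of additive functors $\mathcal{C}\to\mathbf{Ab}$ ($\mathcal{C}$-modules) and $\mathrm{mod}(\mathcal{C})$ its full subcategory of finitely presented functors. With $E$ the injective envelope of $R/\mathrm{rad}(R)$, put $\mathbb{D}_{\mathcal{C}}(M)(X)=\mathrm{Hom}_R(M(X),E)$ for functors with finitely generated values; $\mathcal{C}$ is dualizing if $\mathbb{D}_{\mathcal{C}}$ induces a duality between $\mathrm{mod}(\mathcal{C})$ and $\mathrm{mod}(\mathcal{C}^{op})$. The trace ideal $\mathrm{Tr}_P\mathcal{C}$ is $(\mathrm{Tr}_P\mathcal{C})(A,B)=\mathrm{Tr}_P(\mathrm{Hom}_{\mathcal{C}}(A,-))(B)$, where $\mathrm{Tr}_P(N)\subseteq N$ is the sum of the images of all morphisms $P\to N$. $\mathcal{C}/\mathcal{I}$ is the quotient category (same objects, Hom-sets $\mathrm{Hom}_{\mathcal{C}}(A,B)/\mathcal{I}(A,B)$),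 $\pi:\mathcal{C}\to\mathcal{C}/\mathcal{I}$ the canonical functor, $\pi_{\ast}(F)=F\circ\pi$. $\mathcal{I}$ is $k$-idempotent if the morphism $\mathrm{Ext}^{i}_{\mathrm{Mod}(\mathcal{C}/\mathcal{I})}(F,F')\to\mathrm{Ext}^{i}_{\mathrm{Mod}(\mathcal{C})}(\pi_{\ast}F,\pi_{\ast}F')$ induced by the exact functor $\pi_{\ast}$ is an isomorphism for all $F,F'\in\mathrm{Mod}(\mathcal{C}/\mathcal{I})$ and $0\leq i\leq k$. $J=I_0(P/\mathrm{rad}(P))$ is the injective envelope of $P/\mathrm{rad}(P)$ in $\mathrm{mod}(\mathcal{C})$, where $\mathrm{rad}(P)$ is the intersection of the maximal submodules, and $\mathrm{add}(J)$ is the class of direct summands of finite direct sums of copies of $J$. For $0\leq k\leq\infty$, $\mathbb{I}_k$ is the full subcategory of $\mathrm{mod}(\mathcal{C})$ of those $Y$ having an injective coresolution $0\to Y\to J_0\to J_1\to\cdots$ with $J_i\in\mathrm{add}(J)$ for $0\leq i\leq k$ (all $i\ge0$ if $k=\infty$). *)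

(* Defs.v *)
From HB Require Import structures.
From Stdlib Require Import Relation_Operators.
From mathcomp Require Import all_boot all_algebra.
From mathcomp Require Import boolp functions.

Set Implicit Arguments.
Unset Strict Implicit.
Unset Printing Implicit Defensive.

Import GRing.Theory.

Local Open Scope ring_scope.
Local Open Scope quotient_scope.

#[local] Obligation Tactic := idtac.

(** Submodules and ideals are boolean predicates; since all propositions are
    decidable by [asbool], these are arbitrary subsets. *)

Section SubZmodule.
Variables (V : zmodType) (S : zmodClosed V).

Definition sub_zmod : Type := {x : V | x \in S}.

HB.instance Definition _ := SubChoice.on sub_zmod.
HB.instance Definition _ := [SubChoice_isSubZmodule of sub_zmod by <:].

End SubZmodule.

Section QuotientZmodule.
Variables (V : zmodType) (S : zmodClosed V).

Lemma quot_eq (x y : V) :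
  x - y \in S -> \pi_(Quotient.quot S) x = \pi_(Quotient.quot S) y.
Proof. by rewrite Quotient.idealrBE => /eqP. Qed.

Lemma repr_pi_sub (x : V) : repr (\pi_(Quotient.quot S) x) - x \in S.
Proof. by rewrite Quotient.idealrBE reprK. Qed.

End QuotientZmodule.

Section QuotientLmodule.
Variables (R : pzRingType) (V : lmodType R) (S : submodClosed V).

(** [submodClosed] does not inherit from [zmodClosed], which [quot] needs. *)
Definition submod_pred : {pred V} := fun v => v \in S.

Lemma submod_pred_closed : zmod_closed submod_pred.
Proof.
split=> [|x y Sx Sy]; first exact: rpred0.
by rewrite unfold_in -scaleN1r rpredD ?rpredZ.
Qed.

HB.instance Definition _ :=
  GRing.isZmodClosed.Build V submod_pred submod_pred_closed.

Definition quot_lmod : Type := Quotient.quot submod_pred.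

HB.instance Definition _ := GRing.Zmodule.on quot_lmod.

Definition quot_scale (a : R) (x : quot_lmod) : quot_lmod :=
  \pi_(Quotient.quot submod_pred) (a *: repr (x : Quotient.quot submod_pred)).

Lemma quot_lmodW (Q : quot_lmod -> Prop) :
  (forall v, Q (\pi_(Quotient.quot submod_pred) v)) -> forall x, Q x.
Proof. by move=> Qpi; apply: quotW. Qed.

Lemma quot_lmod_piD (u v : V) :
  \pi_(Quotient.quot submod_pred) (u + v) =
  \pi_(Quotient.quot submod_pred) u + \pi_(Quotient.quot submod_pred) v
  :> quot_lmod.
Proof. exact: raddfD. Qed.

Lemma quot_scale_pi a (v : V) :
  quot_scale a (\pi_(Quotient.quot submod_pred) v) = \pi_(Quotient.quot submod_pred) (a *: v).
Proof.
by apply: quot_eq; rewrite -scalerBr; have := repr_pi_sub submod_pred v; exact: rpredZ.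
Qed.

Lemma quot_scaleA a b x : quot_scale a (quot_scale b x) = quot_scale (a * b) x.
Proof. by elim/quot_lmodW: x => v; rewrite !quot_scale_pi scalerA. Qed.

Lemma quot_scale1 x : quot_scale 1 x = x.
Proof. by elim/quot_lmodW: x => v; rewrite quot_scale_pi scale1r. Qed.

Lemma quot_scaleDr a : {morph quot_scale a : x y / x + y}.
Proof.
elim/quot_lmodW=> u; elim/quot_lmodW=> v.
by rewrite !quot_scale_pi -!quot_lmod_piD quot_scale_pi scalerDr.
Qed.

Lemma quot_scaleDl x a b : quot_scale (a + b) x = quot_scale a x + quot_scale b x.
Proof. by elim/quot_lmodW: x => v; rewrite !quot_scale_pi -quot_lmod_piD scalerDl. Qed.

HB.instance Definition _ := GRing.Zmodule_isLmodule.Build R quot_lmod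
  quot_scaleA quot_scale1 quot_scaleDr (fun x a b => quot_scaleDl x a b).

End QuotientLmodule.

Section RModules.
Variable R : comPzRingType.

Definition artinian : Prop :=
  forall I : nat -> submodClosed R^o,
    (forall n, {subset I n.+1 <= I n}) ->
    exists n, forall m, (n <= m)%N -> I m =i I n.

Definition maximal_ideal (I : submodClosed R^o) : Prop :=
  (1 : R^o) \notin I /\
  forall K : submodClosed R^o, {subset I <= K} -> (1 : R^o) \notin K -> K =i I.

Definition ring_rad : {pred R^o} :=
  fun a => `[< forall I : submodClosed R^o, maximal_ideal I -> a \in I >].

Lemma ring_rad_closed : submod_closed ring_rad.
Proof.
split=> [|a x y /asboolP xr /asboolP yr]; apply/asboolP => I mI.
  exact: rpred0.
by rewrite rpredD ?rpredZ ?xr ?yr.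
Qed.

HB.instance Definition _ :=
  GRing.isSubmodClosed.Build R R^o ring_rad ring_rad_closed.

Definition injective_lmod (E : lmodType R) : Prop :=
  forall (A B : lmodType R) (i : {linear A -> B}) (f : {linear A -> E}),
    injective i -> exists g : {linear B -> E}, forall a, g (i a) = f a.

(** An injective [E] with an essential monomorphism [j : M -> E]. *)
Definition injective_envelope_lmod (M E : lmodType R) : Prop :=
  injective_lmod E /\
  exists j : {linear M -> E}, injective j /\
    forall (N : lmodType R) (g : {linear E -> N}),
      injective (g \o j) -> injective g.

Definition residue_lmod : lmodType R := quot_lmod ring_rad.

End RModules.

Record precat := Precat {
  ob :> Type;
  mor : ob -> ob -> zmodType;
  idm : forall X, mor X X;
  mcomp : forall X Y Z, mor Y Z -> mor X Y -> mor X Z;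
  compA : forall X Y Z T (h : mor Z T) (g : mor Y Z) (f : mor X Y),
    mcomp h (mcomp g f) = mcomp (mcomp h g) f;
  comp1m : forall X Y (f : mor X Y), mcomp (idm Y) f = f;
  compm1 : forall X Y (f : mor X Y), mcomp f (idm X) = f;
  compDl : forall X Y Z (g g' : mor Y Z) (f : mor X Y),
    mcomp (g + g') f = mcomp g f + mcomp g' f;
  compDr : forall X Y Z (g : mor Y Z) (f f' : mor X Y),
    mcomp g (f + f') = mcomp g f + mcomp g f' }.

Arguments idm {p} X.
Arguments mcomp {p X Y Z}.

Section PrecatTheory.
Variable C : precat.

Lemma compBl (X Y Z : C) (g g' : mor Y Z) (f : mor X Y) :
  mcomp (g - g') f = mcomp g f - mcomp g' f.
Proof. by apply: (addIr (mcomp g' f)); rewrite -compDl !subrK. Qed.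

Lemma compBr (X Y Z : C) (g : mor Y Z) (f f' : mor X Y) :
  mcomp g (f - f') = mcomp g f - mcomp g f'.
Proof. by apply: (addIr (mcomp g f')); rewrite -compDr !subrK. Qed.

End PrecatTheory.

Definition opcat (C : precat) : precat :=
  @Precat C (fun X Y => mor Y X) idm (fun X Y Z g f => mcomp f g)
    (fun X Y Z T h g f => esym (compA f g h))
    (fun X Y f => compm1 f) (fun X Y f => comp1m f)
    (fun X Y Z g g' f => compDr f g g') (fun X Y Z g f f' => compDl f f' g).

Record lincat (R : comPzRingType) := Lincat {
  lob : Type;
  lhom : lob -> lob -> lmodType R;
  lidm : forall X, lhom X X;
  lcomp : forall X Y Z, lhom Y Z -> lhom X Y -> lhom X Z;
  lcompA : forall X Y Z T (h : lhom Z T) (g : lhom Y Z) (f : lhom X Y),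
    lcomp h (lcomp g f) = lcomp (lcomp h g) f;
  lcomp1m : forall X Y (f : lhom X Y), lcomp (lidm Y) f = f;
  lcompm1 : forall X Y (f : lhom X Y), lcomp f (lidm X) = f;
  lcomp_linl : forall X Y Z (f : lhom X Y),
    linear (fun g : lhom Y Z => lcomp g f);
  lcomp_linr : forall X Y Z (g : lhom Y Z),
    linear (fun f : lhom X Y => lcomp g f) }.

Section Lincat.
Variables (R : comPzRingType) (C : lincat R).

Lemma lcompDl (X Y Z : lob C) (g g' : lhom Y Z) (f : lhom X Y) :
  lcomp (g + g') f = lcomp g f + lcomp g' f.
Proof. by have := lcomp_linl f 1 g g'; rewrite !scale1r. Qed.

Lemma lcompDr (X Y Z : lob C) (g : lhom Y Z) (f f' : lhom X Y) :
  lcomp g (f + f') = lcomp g f + lcomp g f'.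
Proof. by have := lcomp_linr g 1 f f'; rewrite !scale1r. Qed.

Lemma lcompZl (a : R) (X Y Z : lob C) (g : lhom Y Z) (f : lhom X Y) :
  lcomp (a *: g) f = a *: lcomp g f.
Proof.
have l0 : lcomp (0 : lhom Y Z) f = 0.
  by apply: (addrI (lcomp 0 f)); rewrite -lcompDl !addr0.
by have := lcomp_linl f a g 0; rewrite l0 !addr0.
Qed.

Lemma lcompZr (a : R) (X Y Z : lob C) (g : lhom Y Z) (f : lhom X Y) :
  lcomp g (a *: f) = a *: lcomp g f.
Proof.
have l0 : lcomp g (0 : lhom X Y) = 0.
  by apply: (addrI (lcomp g 0)); rewrite -lcompDr !addr0.
by have := lcomp_linr g a f 0; rewrite l0 !addr0.
Qed.

Definition precat_of : precat :=
  @Precat (lob C) (@lhom R C) (@lidm R C) (@lcomp R C) (@lcompA R C)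
    (@lcomp1m R C) (@lcompm1 R C) lcompDl lcompDr.

End Lincat.

Coercion precat_of : lincat >-> precat.

Definition additive_cat (C : precat) : Prop :=
  (exists Z : C, idm Z = 0) /\
  forall X Y : C, exists (S : C) (i : mor X S) (j : mor Y S)
    (p : mor S X) (q : mor S Y),
    [/\ mcomp p i = idm X, mcomp q j = idm Y, mcomp p j = 0, mcomp q i = 0
      & mcomp i p + mcomp j q = idm S].

Definition idempotents_split (C : precat) : Prop :=
  forall (X : C) (e : mor X X), mcomp e e = e ->
    exists (Y : C) (r : mor X Y) (s : mor Y X),
      mcomp r s = idm Y /\ mcomp s r = e.

Definition hom_finite (R : comPzRingType) (C : lincat R) : Prop :=
  forall X Y : lob C, exists (n : nat) (g : 'I_n -> lhom X Y),
    forall f, exists a : 'I_n -> R, f = \sum_i a i *: g i.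

Definition hom_finite_variety (R : comPzRingType) (C : lincat R) : Prop :=
  [/\ additive_cat C, idempotents_split C & hom_finite C].

Record cmodule (C : precat) := Cmodule {
  val_at :> C -> zmodType;
  mact : forall X Y : C, mor X Y -> val_at X -> val_at Y;
  mactDr : forall X Y (f : mor X Y) x y, mact f (x + y) = mact f x + mact f y;
  mactDl : forall X Y (f g : mor X Y) x, mact (f + g) x = mact f x + mact g x;
  mact1 : forall X x, mact (idm X) x = x;
  mact_comp : forall X Y Z (g : mor Y Z) (f : mor X Y) x,
    mact (mcomp g f) x = mact g (mact f x) }.

Record chom (C : precat) (M N : cmodule C) := Chom {
  capp :> forall X, M X -> N X;
  cappD : forall X x y, capp (x + y) = capp x + capp y :> N X;
  capp_nat : forall X Y (f : mor X Y) (x : M X),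
    capp (mact f x) = mact f (capp x) }.

Section CmoduleTheory.
Variable C : precat.

Lemma mactB (M : cmodule C) (X Y : C) (f : mor X Y) (x y : M X) :
  mact f (x - y) = mact f x - mact f y.
Proof. by apply: (addIr (mact f y)); rewrite -mactDr !subrK. Qed.

HB.instance Definition _ (M : cmodule C) (X Y : C) (f : mor X Y) :=
  GRing.isZmodMorphism.Build (M X) (M Y) (@mact C M X Y f) (@mactB M X Y f).

Lemma cappB (M N : cmodule C) (f : chom M N) (X : C) :
  zmod_morphism (@capp C M N f X).
Proof. by move=> x y; apply: (addIr (f X y)); rewrite -cappD !subrK. Qed.

HB.instance Definition _ (M N : cmodule C) (f : chom M N) (X : C) :=
  GRing.isZmodMorphism.Build (M X) (N X) (@capp C M N f X) (@cappB M N f X).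

Definition eq_chom (M N : cmodule C) (f g : chom M N) : Prop :=
  forall X (x : M X), f X x = g X x.

Program Definition comp_chom (M N K : cmodule C) (g : chom N K) (f : chom M N) :
  chom M K := @Chom C M K (fun X x => g X (f X x)) _ _.
Next Obligation. by move=> *; rewrite /= !cappD. Qed.
Next Obligation. by move=> *; rewrite /= !capp_nat. Qed.

Definition cmono (M N : cmodule C) (f : chom M N) : Prop :=
  forall X, injective (f X).

Definition cepi (M N : cmodule C) (f : chom M N) : Prop :=
  forall X (y : N X), exists x, f X x = y.

Definition exact_at (M N K : cmodule C) (f : chom M N) (g : chom N K) : Prop :=
  forall X (y : N X), g X y = 0 <-> exists x, f X x = y.

Definition is_iso (M N : cmodule C) (f : chom M N) : Prop :=
  exists g : chom N M,
    (forall X x, g X (f X x) = x) /\ (forall X y, f X (g X y) = y).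

Definition cisomorphic (M N : cmodule C) : Prop :=
  exists f : chom M N, is_iso f.

Definition yoneda (A : C) : cmodule C :=
  @Cmodule C (fun X => mor A X) (fun X Y f x => mcomp f x)
    (fun X Y f x y => compDr f x y) (fun X Y f g x => compDl f g x)
    (fun X x => comp1m x) (fun X Y Z g f x => esym (compA g f x)).

Program Definition yoneda_map (A B : C) (f : mor A B) :
  chom (yoneda B) (yoneda A) := @Chom C _ _ (fun X x => mcomp x f) _ _.
Next Obligation. by move=> *; exact: compDl. Qed.
Next Obligation. by move=> *; rewrite /= compA. Qed.

(** When C is additive with split idempotents, the finitely generated projective
    C-modules are the representable ones. *)
Definition finitely_presented (M : cmodule C) : Prop :=
  exists (A B : C) (f : chom (yoneda B) (yoneda A)) (p : chom (yoneda A) M),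
    cepi p /\ exact_at f p.

Definition cprojective (Q : cmodule C) : Prop :=
  forall (M N : cmodule C) (g : chom M N) (f : chom Q N),
    cepi g -> exists h : chom Q M, eq_chom (comp_chom g h) f.

Record submodule (M : cmodule C) := Submodule {
  smem :> forall X, zmodClosed (M X);
  smem_act : forall X Y (f : mor X Y) (x : M X),
    x \in smem X -> mact f x \in smem Y }.

Section SubQuotient.
Variables (M : cmodule C) (S : submodule M).

Definition sub_act (X Y : C) (f : mor X Y) (x : sub_zmod (S X)) :
  sub_zmod (S Y) := exist _ (mact f (val x)) (smem_act f (valP x)).

Program Definition sub_module : cmodule C :=
  @Cmodule C (fun X => sub_zmod (S X)) sub_act _ _ _ _.
Next Obligation. by move=> *; apply: val_inj; exact: mactDr. Qed.
Next Obligation. by move=> *; apply: val_inj; exact: mactDl. Qed.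
Next Obligation. by move=> *; apply: val_inj; exact: mact1. Qed.
Next Obligation. by move=> *; apply: val_inj; exact: mact_comp. Qed.

Definition quot_act (X Y : C) (f : mor X Y) (x : Quotient.quot (S X)) :
  Quotient.quot (S Y) := \pi_(Quotient.quot (S Y)) (mact f (repr x)).

Lemma quot_act_pi (X Y : C) (f : mor X Y) (x : M X) :
  quot_act f (\pi_(Quotient.quot (S X)) x) = \pi_(Quotient.quot (S Y)) (mact f x).
Proof.
by apply: quot_eq; rewrite -raddfB; apply: smem_act; exact: repr_pi_sub.
Qed.

Program Definition quot_module : cmodule C :=
  @Cmodule C (fun X => Quotient.quot (S X)) quot_act _ _ _ _.
Next Obligation.
move=> X Y f; elim/quotW=> x; elim/quotW=> y.
by rewrite -raddfD !quot_act_pi -raddfD mactDr.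
Qed.
Next Obligation.
by move=> X Y f g; elim/quotW=> x; rewrite !quot_act_pi -raddfD mactDl.
Qed.
Next Obligation. by move=> X; elim/quotW=> x; rewrite quot_act_pi mact1. Qed.
Next Obligation.
by move=> X Y Z g f; elim/quotW=> x; rewrite 2!(quot_act_pi _ x) quot_act_pi mact_comp.
Qed.

Definition proper_sub : Prop := exists X (x : M X), x \notin S X.

End SubQuotient.

Definition maximal_sub (M : cmodule C) (S : submodule M) : Prop :=
  proper_sub S /\
  forall T : submodule M, (forall X, {subset S X <= T X}) -> proper_sub T ->
    forall X, T X =i S X.

Definition rad_mem (M : cmodule C) (X : C) : {pred M X} :=
  fun x => `[< forall S : submodule M, maximal_sub S -> x \in S X >].

Lemma rad_mem_closed (M : cmodule C) (X : C) : zmod_closed (@rad_mem M X).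
Proof.
split=> [|x y /asboolP xr /asboolP yr]; apply/asboolP=> S mS.
  exact: rpred0.
by rewrite rpredB ?xr ?yr.
Qed.

HB.instance Definition _ (M : cmodule C) (X : C) :=
  GRing.isZmodClosed.Build (M X) (@rad_mem M X) (@rad_mem_closed M X).

Program Definition cmod_rad (M : cmodule C) : submodule M :=
  @Submodule M (fun X => @rad_mem M X) _.
Next Obligation.
move=> M X Y f x /asboolP xr; apply/asboolP=> S mS.
by apply: smem_act; exact: xr.
Qed.

Definition trace_mem (P N : cmodule C) (X : C) : {pred N X} :=
  fun x => `[< exists s : seq (chom P N * P X), x = \sum_(t <- s) t.1 X t.2 >].

Lemma trace_mem_closed (P N : cmodule C) (X : C) :
  zmod_closed (@trace_mem P N X).
Proof.
split=> [|_ _ /asboolP[s ->] /asboolP[t ->]]; apply/asboolP.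
  by exists [::]; rewrite big_nil.
exists (s ++ [seq (u.1, - u.2) | u <- t]).
rewrite big_cat big_map -sumrN; congr (_ + _).
by apply: eq_bigr => u _; rewrite raddfN.
Qed.

HB.instance Definition _ (P N : cmodule C) (X : C) :=
  GRing.isZmodClosed.Build (N X) (@trace_mem P N X) (@trace_mem_closed P N X).

Program Definition cmod_trace (P N : cmodule C) : submodule N :=
  @Submodule N (fun X => @trace_mem P N X) _.
Next Obligation.
move=> P N X Y f _ /asboolP[s ->]; apply/asboolP.
exists [seq (t.1, mact f t.2) | t <- s].
by rewrite big_map raddf_sum; apply: eq_bigr => t _; rewrite capp_nat.
Qed.

Program Definition cpower (n : nat) (M : cmodule C) : cmodule C :=
  @Cmodule C (fun X => {ffun 'I_n -> M X})
    (fun X Y f x => [ffun i => mact f (x i)]) _ _ _ _.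
Next Obligation. by move=> *; apply/ffunP=> i; rewrite !ffunE mactDr. Qed.
Next Obligation. by move=> *; apply/ffunP=> i; rewrite !ffunE mactDl. Qed.
Next Obligation. by move=> *; apply/ffunP=> i; rewrite !ffunE mact1. Qed.
Next Obligation. by move=> *; apply/ffunP=> i; rewrite !ffunE mact_comp. Qed.

Definition is_direct_sum (S M N : cmodule C) : Prop :=
  exists (i : chom M S) (j : chom N S) (p : chom S M) (q : chom S N),
    [/\ forall X x, p X (i X x) = x, forall X y, q X (j X y) = y,
        forall X y, p X (j X y) = 0, forall X x, q X (i X x) = 0
      & forall X s, i X (p X s) + j X (q X s) = s].

Definition in_add (J Q : cmodule C) : Prop :=
  exists (n : nat) (Q' : cmodule C), is_direct_sum (cpower n J) Q Q'.

(** Injectivity and essentiality below are relative to mod(C), where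
    monomorphisms are the pointwise injective maps. *)

Definition injective_fp (I : cmodule C) : Prop :=
  finitely_presented I /\
  forall (M N : cmodule C) (i : chom M N) (f : chom M I),
    finitely_presented M -> finitely_presented N -> cmono i ->
    exists g : chom N I, eq_chom (comp_chom g i) f.

Definition injective_envelope_fp (M I : cmodule C) : Prop :=
  injective_fp I /\
  exists j : chom M I, cmono j /\
    forall (N : cmodule C) (g : chom I N), finitely_presented N ->
      cmono (comp_chom g j) -> cmono g.

(** [k = None] stands for [k] infinite. *)
Definition II (J : cmodule C) (k : option nat) (Y : cmodule C) : Prop :=
  finitely_presented Y /\
  exists (I : nat -> cmodule C) (e : chom Y (I 0%N))
    (d : forall i, chom (I i) (I i.+1)),
    [/\ cmono e, exact_at e (d 0%N), forall i, exact_at (d i) (d i.+1),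
        forall i, injective_fp (I i)
      & forall i, (if k is Some m then (i <= m)%N else true) ->
          in_add J (I i)].

(** [yext n A B] is the type of exact sequences
    0 -> B -> E_n -> ... -> E_1 -> A -> 0 (for n > 0), where E_i is [yterm i],
    and A and B are identified with [yterm 0] and [yterm n.+1] by [ytop] and
    [ybot].  The values of [yterm] and [ydiff] beyond [n.+1] are irrelevant. *)

Record yext (n : nat) (A B : cmodule C) := Yext {
  yterm : nat -> cmodule C;
  ydiff : forall i, chom (yterm i.+1) (yterm i);
  ytop : chom (yterm 0%N) A;
  ybot : chom B (yterm n.+1);
  ytop_iso : is_iso ytop;
  ybot_iso : is_iso ybot;
  ydiff_epi : cepi (ydiff 0%N);
  ydiff_mono : cmono (ydiff n);
  ydiff_exact : forall i, (i < n)%N -> exact_at (ydiff i.+1) (ydiff i) }.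

Definition yext_mor (n : nat) (A B : cmodule C) (s t : yext n A B) : Prop :=
  exists f : forall i, chom (yterm s i) (yterm t i),
    [/\ forall i, (i <= n)%N ->
          eq_chom (comp_chom (f i) (ydiff s i)) (comp_chom (ydiff t i) (f i.+1)),
        eq_chom (comp_chom (ytop t) (f 0%N)) (ytop s)
      & eq_chom (comp_chom (f n.+1) (ybot s)) (ybot t)].

(** Two n-fold extensions define the same element of Ext^n(A, B). *)
Definition yext_eq (n : nat) (A B : cmodule C) : yext n A B -> yext n A B -> Prop :=
  clos_refl_sym_trans (yext n A B) (@yext_mor n A B).

End CmoduleTheory.

Record cideal (C : precat) := Ideal {
  imem :> forall X Y : C, zmodClosed (mor X Y);
  imem_l : forall (X Y Z : C) (g : mor Y Z) (f : mor X Y),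
    f \in imem X Y -> mcomp g f \in imem X Z;
  imem_r : forall (X Y Z : C) (g : mor Y Z) (f : mor X Y),
    g \in imem Y Z -> mcomp g f \in imem X Z }.

Section IdealTheory.
Variables (C : precat) (I : cideal C).

Definition ideal_sub (A : C) : submodule (yoneda A) :=
  @Submodule C (yoneda A) (fun X => I A X) (fun X Y f x => @imem_l C I A X Y f x).

Definition ideal_at (A : C) : cmodule C := sub_module (ideal_sub A).

Definition qhom (X Y : C) : zmodType := Quotient.quot (I X Y).

Definition qpi (X Y : C) (f : mor X Y) : qhom X Y := \pi_(Quotient.quot (I X Y)) f.

Definition qcomp (X Y Z : C) (g : qhom Y Z) (f : qhom X Y) : qhom X Z :=
  qpi (mcomp (repr (g : Quotient.quot (I Y Z))) (repr (f : Quotient.quot (I X Y)))).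

Lemma qpiD (X Y : C) (f g : mor X Y) : qpi (f + g) = qpi f + qpi g.
Proof. by rewrite /qpi raddfD. Qed.

Lemma qcomp_pi (X Y Z : C) (g : mor Y Z) (f : mor X Y) :
  qcomp (qpi g) (qpi f) = qpi (mcomp g f).
Proof.
apply: quot_eq; set g' := repr _; set f' := repr _.
rewrite -(subrK (mcomp g' f) (mcomp g' f')) -addrA -compBr -compBl rpredD //.
  by apply: imem_l; exact: repr_pi_sub.
by apply: imem_r; exact: repr_pi_sub.
Qed.

Program Definition quot_cat : precat :=
  @Precat C qhom (fun X => qpi (idm X)) qcomp _ _ _ _ _.
Next Obligation.
move=> X Y Z T; elim/quotW=> h; elim/quotW=> g; elim/quotW=> f.
by rewrite -!/(qpi _) !qcomp_pi compA.
Qed.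
Next Obligation.
by move=> X Y; elim/quotW=> f; rewrite -!/(qpi _) !qcomp_pi comp1m.
Qed.
Next Obligation.
by move=> X Y; elim/quotW=> f; rewrite -!/(qpi _) !qcomp_pi compm1.
Qed.
Next Obligation.
move=> X Y Z; elim/quotW=> g; elim/quotW=> g'; elim/quotW=> f.
by rewrite -!/(qpi _) -qpiD !qcomp_pi compDl qpiD.
Qed.
Next Obligation.
move=> X Y Z; elim/quotW=> g; elim/quotW=> f; elim/quotW=> f'.
by rewrite -!/(qpi _) -qpiD !qcomp_pi compDr qpiD.
Qed.

Program Definition pi_star (F : cmodule quot_cat) : cmodule C :=
  @Cmodule C (fun X => F X) (fun X Y f x => @mact quot_cat F X Y (qpi f) x)
    _ _ _ _.
Next Obligation. by move=> *; exact: mactDr. Qed.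
Next Obligation. by move=> F X Y f g x; rewrite /= qpiD; exact: mactDl. Qed.
Next Obligation. by move=> F X x; exact: (@mact1 quot_cat F). Qed.
Next Obligation.
by move=> F X Y Z g f x; rewrite /= -qcomp_pi; exact: (@mact_comp quot_cat F).
Qed.

Program Definition pi_star_map (F G : cmodule quot_cat) (f : chom F G) :
  chom (pi_star F) (pi_star G) := @Chom C _ _ (fun X x => f X x) _ _.
Next Obligation. by move=> F G f X x y; exact: (@cappD quot_cat F G f). Qed.
Next Obligation. by move=> F G f X Y h x; exact: (@capp_nat quot_cat F G f). Qed.

Lemma pi_star_iso (F G : cmodule quot_cat) (f : chom F G) :
  is_iso f -> is_iso (pi_star_map f).
Proof. by case=> g [gK fK]; exists (pi_star_map g). Qed.

Definition pi_star_yext (n : nat) (F G : cmodule quot_cat) (s : yext n F G) :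
  yext n (pi_star F) (pi_star G) :=
  @Yext C n (pi_star F) (pi_star G) (fun i => pi_star (yterm s i))
    (fun i => pi_star_map (ydiff s i)) (pi_star_map (ytop s)) (pi_star_map (ybot s))
    (pi_star_iso (ytop_iso s)) (pi_star_iso (ybot_iso s))
    (@ydiff_epi _ _ _ _ s) (@ydiff_mono _ _ _ _ s) (@ydiff_exact _ _ _ _ s).

(** The map Ext^i(F, G) -> Ext^i(pi_* F, pi_* G) induced by pi_* is bijective;
    Ext^0 is Hom, and for i > 0 the statement is about classes modulo
    [yext_eq]. *)
Definition ext_pi_iso (i : nat) (F G : cmodule quot_cat) : Prop :=
  if i is 0%N then
    (forall f g : chom F G, eq_chom (pi_star_map f) (pi_star_map g) -> eq_chom f g) /\
    (forall h : chom (pi_star F) (pi_star G), exists f, eq_chom (pi_star_map f) h)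
  else
    (forall s t : yext i F G, yext_eq (pi_star_yext s) (pi_star_yext t) -> yext_eq s t) /\
    (forall u : yext i (pi_star F) (pi_star G), exists s, yext_eq (pi_star_yext s) u).

Definition k_idempotent (k : nat) : Prop :=
  forall (F G : cmodule quot_cat) (i : nat), (i <= k)%N -> ext_pi_iso i F G.

End IdealTheory.

Program Definition trace_ideal (C : precat) (P : cmodule C) : cideal C :=
  @Ideal C (fun A B => cmod_trace P (yoneda A) B) _ _.
Next Obligation.
by move=> C P X Y Z g f; exact: (@smem_act C (yoneda X) (cmod_trace P (yoneda X))).
Qed.
Next Obligation.
move=> C P X Y Z g f /asboolP[s ->]; apply/asboolP.
exists [seq (comp_chom (yoneda_map f) t.1, t.2) | t <- s].
by rewrite big_map /= -[LHS]/(yoneda_map f Z _) raddf_sum.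
Qed.

Section Duality.
Variables (R : comPzRingType) (E : lmodType R) (C : lincat R).

(** The R-module structure on M(X): a acts as M(a id_X). *)
Section ValueModule.
Variables (M : cmodule C) (X : C).

Definition rval : Type := M X.

HB.instance Definition _ := GRing.Zmodule.on rval.

Definition rval_scale (a : R) (x : rval) : rval :=
  @mact C M X X (a *: lidm X) x.

Lemma rval_scaleA a b x : rval_scale a (rval_scale b x) = rval_scale (a * b) x.
Proof.
rewrite /rval_scale -mact_comp; congr (mact _ x).
by rewrite /= lcompZl lcomp1m scalerA.
Qed.

Lemma rval_scale1 x : rval_scale 1 x = x.
Proof. by rewrite /rval_scale scale1r; exact: (@mact1 C M X). Qed.

Lemma rval_scaleDr a : {morph rval_scale a : x y / x + y}.
Proof. by move=> x y; exact: mactDr. Qed.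

Lemma rval_scaleDl x a b : rval_scale (a + b) x = rval_scale a x + rval_scale b x.
Proof. by rewrite /rval_scale scalerDl; exact: mactDl. Qed.

HB.instance Definition _ := GRing.Zmodule_isLmodule.Build R rval
  rval_scaleA rval_scale1 rval_scaleDr (fun x a b => rval_scaleDl x a b).

Definition linear_mem : {pred rval -> E} := fun f => `[< linear f >].

Lemma linear_mem_closed : zmod_closed linear_mem.
Proof.
split=> [|f g /asboolP lf /asboolP lg]; apply/asboolP=> a x y /=.
  by rewrite scaler0 addr0.
by rewrite !fctE lf lg scalerBr addrACA opprD.
Qed.

HB.instance Definition _ :=
  GRing.isZmodClosed.Build (rval -> E) linear_mem linear_mem_closed.

Definition rdual : zmodType := sub_zmod linear_mem.

End ValueModule.

Lemma mact_linear (M : cmodule C) (X Y : C) (h : mor X Y) :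
  linear (fun x : rval M X => @mact C M X Y h x : rval M Y).
Proof.
move=> a x y; rewrite mactDr; congr (_ + _).
rewrite /GRing.scale /= /rval_scale -!mact_comp; congr (mact _ x).
by rewrite /= lcompZr lcompm1 lcompZl lcomp1m.
Qed.

Program Definition dual_act (M : cmodule C) (X Y : C) (h : mor X Y)
  (u : rdual M Y) : rdual M X :=
  exist _ (fun x => val u (@mact C M X Y h x)) _.
Next Obligation.
move=> M X Y h u; apply/asboolP=> a x y /=.
by rewrite mact_linear; move/asboolP: (valP u) => ->.
Qed.

Program Definition cdual (M : cmodule C) : cmodule (opcat C) :=
  @Cmodule (opcat C) (fun X => rdual M X) (fun X Y h u => @dual_act M Y X h u)
    _ _ _ _.
Next Obligation. by move=> *; apply: val_inj; apply/funext. Qed.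
Next Obligation.
move=> M X Y f g u; apply: val_inj; apply/funext => x /=.
have := @mactDl C M Y X f g x; rewrite /= => ->.
move/asboolP: (valP u) => /(_ 1 (@mact C M Y X f x) (@mact C M Y X g x)).
by rewrite !scale1r.
Qed.
Next Obligation.
by move=> M X u; apply: val_inj; apply/funext => x /=; rewrite (@mact1 C M).
Qed.
Next Obligation.
move=> M X Y Z g f u; apply: val_inj; apply/funext => x /=.
by rewrite (@mact_comp C M).
Qed.

Lemma chom_linear (M N : cmodule C) (f : chom M N) (X : C) :
  linear (fun x : rval M X => f X x : rval N X).
Proof.
move=> a x y; rewrite cappD; congr (_ + _).
exact: (@capp_nat C M N f X X).
Qed.

Program Definition dual_app (M N : cmodule C) (f : chom M N) (X : C)
  (u : rdual N X) : rdual M X := exist _ (fun x => val u (f X x)) _.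
Next Obligation.
move=> M N f X u; apply/asboolP=> a x y /=.
by rewrite chom_linear; move/asboolP: (valP u) => ->.
Qed.

Program Definition dual_map (M N : cmodule C) (f : chom M N) :
  chom (cdual N) (cdual M) :=
  @Chom (opcat C) (cdual N) (cdual M) (fun X u => @dual_app M N f X u) _ _.
Next Obligation. by move=> *; apply: val_inj; apply/funext. Qed.
Next Obligation.
move=> M N f X Y h u; apply: val_inj; apply/funext => x /=.
by rewrite capp_nat.
Qed.

(** D restricts to a contravariant equivalence mod(C) -> mod(C^op):
    well defined, fully faithful and dense. *)
Definition dual_is_duality : Prop :=
  [/\ forall M : cmodule C, finitely_presented M -> finitely_presented (cdual M),
      forall (M N : cmodule C) (f g : chom M N),
        finitely_presented M -> finitely_presented N ->
        eq_chom (dual_map f) (dual_map g) -> eq_chom f g,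
      forall (M N : cmodule C) (h : chom (cdual N) (cdual M)),
        finitely_presented M -> finitely_presented N ->
        exists f : chom M N, eq_chom (dual_map f) h
    & forall N : cmodule (opcat C), finitely_presented N ->
        exists M : cmodule C, finitely_presented M /\ cisomorphic (cdual M) N].

Definition dualizing_variety : Prop :=
  hom_finite_variety C /\ dual_is_duality.

End Duality.

(* Main.v *)
From HB Require Import structures.
From Stdlib Require Import Relation_Operators.
Require Import Defs.
From mathcomp Require Import all_boot all_algebra.
From mathcomp Require Import boolp functions.

(** Write [I] for the trace ideal of [P = Hom(c,-)]: [I(X,Y)] consists of the maps
that factor through a finite power of [c].  Call [x] in [M(X)] torsion when
every map [X -> c] annihilates it, equivalently when [I] does, and write add(c)
for the objects whose identity lies in [I]; a torsion element over such an
object is zero.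

The duality provides, for each object [A], an injective module that corepresents
[Y |-> Hom_R(Y(A), E)] ([corepresenting]).  So mod(C) has kernels and enough
injectives, and comparison with the corepresenting module of [c] identifies what
add(J) sees: [J] is torsion-free, and every finitely presented module has a map
to a power of [J] whose kernel is exactly its torsion ([envelope_torsion_free],
[torsion_kernel]).

From (b) to (a).  If [I(X,-)] is projective, it is represented by an object [D]
of add(c): there is [eps : X -> D] through which every map in [I(X,-)] factors
uniquely ([reflection_exists]), so add(c) is reflective in [C].  For
[Q_0 -> Q_1] in add(J), a torsion element of the cokernel comes from some
[y] in [Q_1(X)] with [eps y] in the image of [Q_0]; injectivity of [Q_0] along
the monomorphism [Hom(D,-) -> Hom(X,-)] then puts [y] itself in the image.  The
cokernel is therefore torsion-free and embeds in a power of [J], and the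
coresolution continues inside add(J) ([II_one_infinite]).  For 2-idempotence, the
right adjoint [rho] of restriction along [C -> C/I] takes [M] to its elements
annihilated by [I].  It carries extensions to extensions once they are replaced,
functorially, by ones on which it is exact: nothing has to be done in degree 1,
and in degree 2 one pushes out along the embedding of the middle term in a
coinduced module, for which evaluation at [eps] is surjective
([push_rho_exact]).  Restriction and [rho] are then mutually inverse on Yoneda
classes ([ext_iso_of_replacement]).

From (a) to (b).  Choose [alpha : X -> D] with [D] in add(c) through which every
map in [I(X,-)] factors, and let [L] be the kernel of [Hom(D,-) -> Hom(X,-)].
- [L] is generated by [L(c)].  Otherwise, with [T] the part generated by [L(c)],
  the 2-extension 0 -> L/T -> Hom(D,-)/T -> Hom(X,-) -> Hom(X,-)/I(X,-) -> 0 has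
  a nonzero class between two C/I-modules, of which Hom(X,-)/I(X,-) is projective
  over C/I; this contradicts surjectivity on Ext^2 ([kernel_generated]).
- [L] maps to a module [Y] in [II J (Some 1)], bijectively over add(c)
  ([torsion_closure]).  As [Y] is then in [II J None], the map
  extends to [Hom(D,-) -> Y], hence, [D] being in add(c), to [Hom(D,-) -> L],
  which restricts to the identity on [L(c)] and so on [L]
  ([retraction_exists]).
Thus [I(X,-) = Hom(D,-)/L] is a direct summand of [Hom(D,-)]. *)

Set Implicit Arguments.
Unset Strict Implicit.
Unset Printing Implicit Defensive.

Import GRing.Theory.

Local Open Scope ring_scope.
Local Open Scope quotient_scope.

#[local] Obligation Tactic := idtac.

(** * Linear algebra over a commutative artinian ring *)

Section Submodules.
Variables (R : comPzRingType) (V : lmodType R).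

(** Submodules as plain predicates: chains and minimal members of families are
    easier to form this way than with packed closed predicates. *)
Definition is_submod (S : V -> Prop) : Prop :=
  S 0 /\ forall a x y, S x -> S y -> S (a *: x + y).

Section Pack.
Variables (S : V -> Prop) (hS : is_submod S).

(** The closure proof is an argument so that the packed structure can be inferred. *)
Definition submod_of (_ : is_submod S) : {pred V} := fun v => `[< S v >].

Lemma submod_of_closed : submod_closed (submod_of hS).
Proof.
case: hS => S0 SD; split=> [|a x y /asboolP Sx /asboolP Sy]; apply/asboolP=> //.
exact: SD.
Qed.

HB.instance Definition _ :=
  GRing.isSubmodClosed.Build R V (submod_of hS) submod_of_closed.

Lemma submod_ofP v : reflect (S v) (v \in submod_of hS).
Proof. exact: asboolP. Qed.

Lemma submodB x y : S x -> S y -> S (x - y).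
Proof.
case: hS => _ SD Sx Sy; have := SD (-1) y x Sy Sx.
by rewrite scaleN1r addrC.
Qed.

Lemma submodD x y : S x -> S y -> S (x + y).
Proof. by case: hS => _ SD Sx Sy; have := SD 1 x y Sx Sy; rewrite scale1r. Qed.

Lemma submodZ a x : S x -> S (a *: x).
Proof. by case: hS => S0 SD Sx; have := SD a x 0 Sx S0; rewrite addr0. Qed.

End Pack.

Lemma submod_closed_is_submod (S : submodClosed V) : is_submod (fun v => v \in S).
Proof. by split=> [|a x y Sx Sy]; rewrite ?rpred0 ?rpredD ?rpredZ. Qed.

Lemma is_submodI (S T : V -> Prop) :
  is_submod S -> is_submod T -> is_submod (fun v => S v /\ T v).
Proof.
by move=> [S0 SD] [T0 TD]; split=> // a x y [? ?] [? ?]; split; [apply: SD|apply: TD].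
Qed.

Definition dcc : Prop :=
  forall S : nat -> V -> Prop,
    (forall n, is_submod (S n)) -> (forall n v, S n.+1 v -> S n v) ->
    exists n, forall m, (n <= m)%N -> forall v, S n v -> S m v.

Lemma dcc_minimal (Q : (V -> Prop) -> Prop) :
  dcc -> (forall S, Q S -> is_submod S) -> (exists S, Q S) ->
  exists S, Q S /\ forall T, Q T -> (forall v, T v -> S v) -> forall v, S v -> T v.
Proof.
move=> hd Qs [S0 QS0]; apply: contrapT => nmin.
have step (S : {S | Q S}) : exists T : {S | Q S},
    (forall v, sval T v -> sval S v) /\ ~ (forall v, sval S v -> sval T v).
  apply: contrapT => nT; apply: nmin; exists (sval S); split; first exact: svalP S.
  move=> T QT TS; apply: contrapT => nST.
  by apply: nT; exists (exist _ T QT).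
have [nxt nxtP] := choice step.
pose s n := iter n nxt (exist _ S0 QS0).
have [n hn] := hd (fun n => sval (s n)) (fun n => Qs _ (svalP (s n)))
  (fun n => (nxtP (s n)).1).
by apply: (nxtP (s n)).2; exact: (hn n.+1 (leqnSn n)).
Qed.

End Submodules.

Section Linear.
Variables (R : comPzRingType).

Section Pack.
Variables (A B : lmodType R) (f : A -> B) (hf : linear f).
(** The linearity proof is an argument for the same reason as in [submod_of]. *)
Definition lin_of (_ : linear f) : A -> B := f.
HB.instance Definition _ := GRing.isLinear.Build R A B *:%R (lin_of hf) hf.
Definition to_linear : {linear A -> B} := lin_of hf.
End Pack.

Lemma linear0_of (A B : lmodType R) (f : A -> B) : linear f -> f 0 = 0.
Proof. by move=> hf; exact: (linear0 (to_linear hf)). Qed.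

Lemma linearB_of (A B : lmodType R) (f : A -> B) :
  linear f -> forall x y, f (x - y) = f x - f y.
Proof. by move=> hf; exact: (linearB (to_linear hf)). Qed.

Lemma linearZ_of (A B : lmodType R) (f : A -> B) :
  linear f -> forall a x, f (a *: x) = a *: f x.
Proof. by move=> hf a x; have := hf a x 0; rewrite (linear0_of hf) !addr0. Qed.

Lemma linearD_of (A B : lmodType R) (f : A -> B) :
  linear f -> forall x y, f (x + y) = f x + f y.
Proof. by move=> hf x y; have := hf 1 x y; rewrite !scale1r. Qed.

Lemma linear_combination_of (A B : lmodType R) (f : A -> B) (I : Type) (r : seq I)
    (a : I -> R) (g : I -> A) :
  linear f -> f (\sum_(i <- r) a i *: g i) = \sum_(i <- r) a i *: f (g i).
Proof.
move=> hf; elim/big_rec2: _ => [|i x y _ <-]; first exact: linear0_of.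
exact: hf.
Qed.

Lemma linear_of (A B : lmodType R) (f : {linear A -> B}) : linear f.
Proof. by move=> a x y; rewrite linearP. Qed.

Lemma linear_comp (A B D : lmodType R) (f : A -> B) (g : B -> D) :
  linear f -> linear g -> linear (g \o f).
Proof. by move=> hf hg a x y /=; rewrite hf hg. Qed.

Lemma quot_lmod_pi_linear (V : lmodType R) (S : submodClosed V) :
  linear (fun v => \pi_(Quotient.quot (submod_pred S)) v : quot_lmod S).
Proof. by move=> a x y; rewrite quot_lmod_piD -quot_scale_pi. Qed.

Lemma quot_lmod_lift (V W : lmodType R) (S : submodClosed V) (g : V -> W) :
  linear g -> (forall v, v \in S -> g v = 0) ->
  exists2 h : quot_lmod S -> W, linear h
    & forall v, h (\pi_(Quotient.quot (submod_pred S)) v) = g v.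
Proof.
move=> hg g0; pose h (x : quot_lmod S) := g (repr (x : Quotient.quot (submod_pred S))).
have hpi v : h (\pi_(Quotient.quot (submod_pred S)) v) = g v.
  apply/eqP; rewrite -subr_eq0 -(linearB_of hg); apply/eqP/g0.
  exact: (repr_pi_sub (submod_pred S) v).
exists h => // a; elim/quot_lmodW=> u; elim/quot_lmodW=> v.
by rewrite -quot_lmod_pi_linear !hpi hg.
Qed.

End Linear.

Section Cogenerator.
Variables (R : comPzRingType) (hR : artinian R) (E : lmodType R)
  (hE : injective_envelope_lmod (residue_lmod R) E).

Lemma artinian_dcc : @dcc R R^o.
Proof.
move=> S Ssub Sdec.
pose I n : submodClosed R^o := submod_of (Ssub n).
have [n v|n hn] := @hR I; first by move=> /submod_ofP /Sdec Sv; apply/submod_ofP.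
exists n => m nm v Sv; apply/(submod_ofP (Ssub m)).
by rewrite hn //; apply/submod_ofP.
Qed.

Lemma injective_extend (A B : lmodType R) (i : A -> B) (f : A -> E) :
  linear i -> injective i -> linear f ->
  exists2 g : B -> E, linear g & forall a, g (i a) = f a.
Proof.
move=> hi ii hf; have [hinj _] := hE.
by have [g gP] := hinj A B (to_linear hi) (to_linear hf) ii; exists g => //; exact: linear_of.
Qed.

(** The ideals of the [a] with [a m] in [R b m], for [b m <> 0], have a minimal
    member, and there [b m] generates a simple module. *)
Lemma simple_multiple (V : lmodType R) (m : V) : m <> 0 ->
  exists2 b : R, b *: m <> 0 &
    forall a : R, a *: (b *: m) <> 0 -> exists r : R, b *: m = r *: (a *: (b *: m)).
Proof.
move=> m0; pose A (b : R) : R^o -> Prop := fun a => exists r : R, a *: m = r *: (b *: m).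
have Asub b : is_submod (A b).
  split=> [|a x y [r xr] [s ys]]; first by exists 0; rewrite !scale0r.
  exists (a * r + s); rewrite [a *: x]/(a * x) scalerDl -scalerA xr ys.
  by rewrite scalerDl -!scalerA.
pose Q S := exists2 b : R, b *: m <> 0 & S = A b.
have [_ [b _ ->] //||_ [[b b0 ->] Smin]] := @dcc_minimal R R^o Q artinian_dcc.
  by exists (A 1), 1 => //; rewrite scale1r.
exists b => // a ab0.
have [|||r br] := Smin (A (a * b)) _ _ b.
- by exists (a * b) => //; rewrite -scalerA.
- by move=> x [r xr]; exists (r * a); rewrite xr !scalerA mulrA.
- by exists 1; rewrite scale1r.
by exists r; rewrite [RHS]scalerA [RHS]scalerA -mulrA -scalerA -br.
Qed.

(** A minimal ideal [N] among those not contained in [m] lies in every other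
    maximal ideal [k], because [N] meets [k] outside the prime ideal [m].  So an
    element of [N] outside [m] is annihilated by [m] modulo the radical: the
    residue field of [m] embeds in [R/rad(R)]. *)
Lemma maximal_ideal_separated (m : submodClosed R^o) : maximal_ideal m ->
  exists2 a : R, a \notin m &
    forall r : R, r \in m -> r * a \in @ring_rad R.
Proof.
move=> [m1 mmax].
pose M : R^o -> Prop := fun r => r \in m.
have Ms : is_submod M by exact: submod_closed_is_submod.
have mprime (x y : R) : x \notin m -> M (x * y) -> M y.
  move=> xm xym.
  have Ks : @is_submod R R^o (fun z => exists r : R, M (z - r * x)).
    split=> [|a u v [r ur] [s vs]]; first by exists 0; rewrite mul0r subr0; case: Ms.
    exists (a * r + s); rewrite mulrDl opprD addrACA -mulrA.
    by rewrite [a *: u]/(a * u) -mulrBr; exact: (submodD Ms (submodZ Ms a ur) vs).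
  have [K1|nK1] := pselect ((1 : R^o) \in submod_of Ks).
    have /submod_ofP := K1; case=> r r1.
    have := submodD Ms (submodZ Ms y r1) (submodZ Ms r xym).
    rewrite /GRing.scale /= mulrBr mulr1.
    by rewrite (mulrCA y r x) [x * y]mulrC subrK.
  exfalso; have mK : {subset m <= submod_of Ks}.
    by move=> z zm; apply/submod_ofP; exists 0; rewrite mul0r subr0.
  case/negP: xm; rewrite -(mmax (submod_of Ks) mK) //; last exact/negP.
  by apply/submod_ofP; exists 1; rewrite mul1r subrr; case: Ms.
pose Q (S : R^o -> Prop) := is_submod S /\ exists2 a, S a & a \notin m.
have [S [] //||N [[Ns [a Na am]] Nmin]] := @dcc_minimal R R^o Q artinian_dcc.
  by exists (fun => True); split=> //; exists 1.
exists a => // r rm; apply/asboolP => k [k1 kmax].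
have [km|nkm] := pselect (forall b, b \in k -> b \in m).
  by have <- := kmax m km m1; rewrite mulrC; exact: (rpredZ a rm).
apply: (rpredZ r); move: (a) (Na).
suff Nk : forall v, N v -> N v /\ v \in k by move=> v /Nk[].
apply: Nmin => [|v []//]; split.
  exact: is_submodI Ns (submod_closed_is_submod k).
have [b bk bm] : exists2 b, b \in k & b \notin m.
  apply: contrapT => nb; apply: nkm => b bk; apply: contrapT => /negP bm.
  by apply: nb; exists b.
exists (a * b); last by apply/negP=> /(mprime _ _ am); exact/negP.
split; last exact: (rpredZ a bk).
by rewrite mulrC; exact: (submodZ Ns b Na).
Qed.

(** A multiple [v] of [m] generates a simple module [R/ann(v)], which embeds in
    [R/rad(R)] and so in [E]; extend by injectivity. *)
Lemma cogenerator_neq0 (V : lmodType R) (m : V) : m <> 0 ->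
  exists2 f : V -> E, linear f & f m <> 0.
Proof.
case/simple_multiple=> b b0 bmul; set v := b *: m in b0 bmul.
suff [f hf fv] : exists2 f : V -> E, linear f & f v <> 0.
  by exists f => // fm; apply: fv; rewrite /v (linearZ_of hf) fm scaler0.
have As : @is_submod R R^o (fun a : R => a *: v = 0).
  split=> [|a x y xv yv]; first by rewrite scale0r.
  by rewrite [a *: x]/(a * x) scalerDl yv addr0 -scalerA xv scaler0.
pose A : submodClosed R^o := submod_of As.
have Amax : maximal_ideal A.
  split=> [|K AK K1 a]; first by apply/negP=> /(submod_ofP As); rewrite scale1r.
  apply/idP/idP=> [Ka|/AK //]; apply/(submod_ofP As); apply: contrapT => /bmul[r vr].
  case/negP: K1; rewrite -(subrK (r * a) 1); apply: (@rpredD _ (K : submodClosed R^o)).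
    apply: AK; apply/(submod_ofP As).
    by rewrite scalerBl scale1r -scalerA -vr subrr.
  exact: (rpredZ r Ka).
have [a am aA] := maximal_ideal_separated Amax.
have [_ [j [jinj _]]] := hE.
pose e := j (\pi_(Quotient.quot (submod_pred (@ring_rad R))) (a : R^o) : residue_lmod R).
have pi0 (r : R^o) : r \in @ring_rad R ->
    \pi_(Quotient.quot (submod_pred (@ring_rad R))) r = 0 :> residue_lmod R.
  move=> rr; rewrite -[0](linear0_of (quot_lmod_pi_linear (@ring_rad R))).
  by apply: quot_eq; rewrite subr0.
have e0 : e <> 0.
  move=> e0; case/negP: am; have : a \in @ring_rad R; last by move/asboolP; exact.
  have /jinj : j (\pi_(Quotient.quot (submod_pred (@ring_rad R))) (a : R^o) : residue_lmod R) = j 0.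
    by rewrite linear0.
  rewrite -[0](linear0_of (quot_lmod_pi_linear (@ring_rad R))) => /eqP.
  by rewrite -Quotient.idealrBE subr0.
have lin (W : lmodType R) (w : W) : linear (fun r : R^o => r *: w).
  by move=> x y z; rewrite scalerDl scalerA.
have [i hi iE] := @quot_lmod_lift R R^o V A _ (lin V v) (fun r rA => elimT (submod_ofP As r) rA).
have [|f hf fE] := @quot_lmod_lift R R^o E A _ (lin E e).
  move=> r /aA ra; rewrite /e -linearZ /=.
  rewrite -(linearZ_of (quot_lmod_pi_linear (@ring_rad R)) r a).
  by rewrite [X in j X]pi0 // linear0.
have [|g hg gE] := injective_extend hi _ hf.
  elim/quot_lmodW=> x; elim/quot_lmodW=> y; rewrite !iE => /eqP.
  rewrite -subr_eq0 -scalerBl => /eqP xy; apply: quot_eq.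
  exact/(submod_ofP As).
exists g => //; have := gE (\pi_(Quotient.quot (submod_pred A)) (1 : R^o)).
by rewrite iE fE !scale1r => ->.
Qed.

(** Passing to the quotient by [S] reduces to separating a nonzero vector
    from [0]. *)
Lemma cogenerator (V : lmodType R) (S : V -> Prop) (v : V) :
  is_submod S -> ~ S v ->
  exists f : V -> E, [/\ linear f, forall s, S s -> f s = 0 & f v <> 0].
Proof.
move=> hS Sv; have hp := quot_lmod_pi_linear (submod_of hS).
have [|f hf fv] := @cogenerator_neq0 (quot_lmod (submod_of hS))
    (\pi_(Quotient.quot (submod_pred (submod_of hS))) v).
  rewrite -[0](linear0_of hp) => /eqP.
  by rewrite -Quotient.idealrBE subr0 => /(submod_ofP hS).
exists (fun v => f (\pi_(Quotient.quot (submod_pred (submod_of hS))) v)); split=> //.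
  exact: linear_comp hp hf.
move=> s Ss; rewrite -(linear0_of hf) -[in RHS](linear0_of hp); congr f.
by apply: quot_eq; rewrite subr0; apply/(submod_ofP hS).
Qed.

Section FiniteGeneration.
Variable V : lmodType R.

Fixpoint in_span (s : seq V) (v : V) : Prop :=
  if s is g :: s' then exists a w, in_span s' w /\ v = a *: g + w else v = 0.

Lemma in_span_submod s : is_submod (in_span s).
Proof.
elim: s => [|g s IH] /=; first by split=> // a x y -> ->; rewrite scaler0 addr0.
split; first by exists 0, 0; rewrite scale0r addr0; split=> //; case: IH.
move=> a _ _ [b [x [xs ->]]] [b' [y [ys ->]]].
exists (a * b + b'), (a *: x + y); split; first by case: IH => _; exact.
by rewrite scalerDr scalerA addrACA scalerDl.
Qed.

(** Induction on the number of generators: a chain is controlled by its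
    intersection with the span of the tail and by the ideals of the coefficients
    that the first generator takes in it. *)
Lemma in_span_dcc s (S : nat -> V -> Prop) :
  (forall n, is_submod (S n)) -> (forall n v, S n.+1 v -> S n v) ->
  (forall n v, S n v -> in_span s v) ->
  exists n, forall m, (n <= m)%N -> forall v, S n v -> S m v.
Proof.
elim: s S => [|g s IH] S Ssub Sdec Sspan.
  by exists 0%N => m _ v /Sspan /= ->; case: (Ssub m).
have mono n m : (n <= m)%N -> forall v, S m v -> S n v.
  by move/subnK<-; elim: (m - n)%N => // k IHk v /Sdec; exact: IHk.
have [|||n1 h1] := IH (fun n v => S n v /\ in_span s v).
- by move=> n; exact: is_submodI (Ssub n) (in_span_submod s).
- by move=> n v [/Sdec].
- by move=> n v [].
pose A n : R^o -> Prop := fun a => exists w, in_span s w /\ S n (a *: g + w).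
have As n : is_submod (A n).
  split; first by exists 0; rewrite scale0r addr0; case: (in_span_submod s) (Ssub n) => ? _ [].
  move=> a x y [w [ws wS]] [w' [ws' wS']].
  exists (a *: w + w'); split; first by case: (in_span_submod s) => _; exact.
  rewrite [a *: x]/(a * x) scalerDl addrACA -scalerA -scalerDr.
  by case: (Ssub n) => _; exact.
have [|n2 h2] := artinian_dcc As.
  by move=> n a [w [ws /Sdec wS]]; exists w.
exists (maxn n1 n2) => m nm v Sv.
have [a [w [ws vE]]] := Sspan _ _ Sv.
have [||w' [ws' Sw']] := h2 m _ a; first by rewrite (leq_trans _ nm) ?leq_maxr.
  by exists w; split=> //; rewrite -vE; apply: mono Sv; rewrite leq_maxr.
have Sd : S (maxn n1 n2) (v - (a *: g + w')) by exact: submodB (Ssub _) _ _ Sv (mono _ _ nm _ Sw').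
rewrite -(subrK (a *: g + w') v); apply: submodD (Ssub m) _ _ _ Sw'.
apply: (proj1 (h1 m _ _ _)); first by rewrite (leq_trans _ nm) ?leq_maxl.
split; first by apply: mono Sd; rewrite leq_maxl.
rewrite vE [X in X - _]addrC addrKA; exact: submodB (in_span_submod s) _ _ ws ws'.
Qed.

Lemma in_span_sum (n : nat) (g : 'I_n -> V) (a : 'I_n -> R) :
  in_span [seq g i | i <- enum 'I_n] (\sum_i a i *: g i).
Proof.
rewrite -big_enum /=; elim: (enum 'I_n) => [|i s IH] /=; first by rewrite big_nil.
by rewrite big_cons; exists (a i), (\sum_(j <- s) a j *: g j).
Qed.

Lemma spanned_dcc s : (forall v, in_span s v) -> dcc V.
Proof. by move=> hs S Ssub Sdec; apply: (in_span_dcc (s := s)). Qed.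

End FiniteGeneration.

End Cogenerator.

(** * Modules over a preadditive category *)

Section Cmodules.
Variable C : precat.
Implicit Types M N K : cmodule C.

Lemma chomB M N (f : chom M N) (X : C) (x y : M X) : f X (x - y) = f X x - f X y.
Proof. exact: raddfB. Qed.

Lemma chomN M N (f : chom M N) (X : C) (x : M X) : f X (- x) = - f X x.
Proof. exact: raddfN. Qed.

Lemma chom0 M N (f : chom M N) (X : C) : f X 0 = 0.
Proof. exact: raddf0. Qed.

Lemma mact0r M (X Y : C) (f : mor X Y) : mact f (0 : M X) = 0.
Proof. exact: raddf0. Qed.

Lemma mactN M (X Y : C) (f : mor X Y) (x : M X) : mact f (- x) = - mact f x.
Proof. exact: raddfN. Qed.

Lemma mact0l M (X Y : C) (x : M X) : mact (0 : mor X Y) x = 0.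
Proof. by apply: (addrI (mact 0 x)); rewrite -mactDl !addr0. Qed.

Lemma mactBl M (X Y : C) (f g : mor X Y) (x : M X) :
  mact (f - g) x = mact f x - mact g x.
Proof. by apply: (addIr (mact g x)); rewrite -mactDl !subrK. Qed.

Lemma mact_suml M (X Y : C) (I : Type) (r : seq I) (F : I -> mor X Y) (x : M X) :
  mact (\sum_(i <- r) F i) x = \sum_(i <- r) mact (F i) x.
Proof.
by elim/big_rec2: _ => [|i y f _ <-]; rewrite ?mact0l ?mactDl.
Qed.

Lemma mcompA (X Y Z T : C) (h : mor Z T) (g : mor Y Z) (f : mor X Y) :
  mcomp h (mcomp g f) = mcomp (mcomp h g) f.
Proof. exact: Defs.compA. Qed.

Lemma comp0m (X Y Z : C) (f : mor X Y) : mcomp (0 : mor Y Z) f = 0.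
Proof. exact: (mact0l (M := yoneda X)). Qed.

Lemma compm0 (X Y Z : C) (g : mor Y Z) : mcomp g (0 : mor X Y) = 0.
Proof. exact: (mact0r (yoneda X) g). Qed.

Lemma comp_suml (X Y Z : C) (I : Type) (r : seq I) (F : I -> mor Y Z) (f : mor X Y) :
  mcomp (\sum_(i <- r) F i) f = \sum_(i <- r) mcomp (F i) f.
Proof. exact: (mact_suml (M := yoneda X)). Qed.

Lemma comp_sumr (X Y Z : C) (I : Type) (r : seq I) (g : mor Y Z) (F : I -> mor X Y) :
  mcomp g (\sum_(i <- r) F i) = \sum_(i <- r) mcomp g (F i).
Proof. by elim/big_rec2: _ => [|i y f _ <-]; rewrite ?compm0 ?compDr. Qed.

(** Morphisms are obtained below by lifting or factoring pointwise; a functional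
    relation compatible with the structure is all that has to be exhibited. *)
Lemma chom_of_rel M N (P : forall X, M X -> N X -> Prop) :
  (forall X x, exists y, P X x y) ->
  (forall X x y y', P X x y -> P X x y' -> y = y') ->
  (forall X x x' y y', P X x y -> P X x' y' -> P X (x + x') (y + y')) ->
  (forall X Y (f : mor X Y) x y, P X x y -> P Y (mact f x) (mact f y)) ->
  exists f : chom M N, forall X x, P X x (f X x).
Proof.
move=> tot fun_ add nat_; pose F X x := projT1 (cid (tot X x)).
have FP X x : P X x (F X x) by exact: projT2 (cid (tot X x)).
have FD X x y : F X (x + y) = F X x + F X y.
  by apply: fun_ (FP _ _) _; exact: add.
have Fnat X Y (f : mor X Y) x : F Y (mact f x) = mact f (F X x).
  by apply: fun_ (FP _ _) _; exact: nat_.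
by exists (Chom FD Fnat).
Qed.

Lemma factor_epi M N K (p : chom M N) (g : chom M K) :
  cepi p -> (forall X x, p X x = 0 -> g X x = 0) ->
  exists h : chom N K, forall X x, h X (p X x) = g X x.
Proof.
move=> pe pg.
have [|||X Y f _ _ [a <- <-]|h hP] := @chom_of_rel N K
    (fun X y z => exists2 x, p X x = y & g X x = z).
- by move=> X y; have [x <-] := pe X y; exists (g X x); exists x.
- move=> X y _ _ [a <- <-] [b ab <-]; apply/eqP; rewrite -subr_eq0 -chomB.
  by apply/eqP/pg; rewrite chomB ab subrr.
- by move=> X _ _ _ _ [a <- <-] [b <- <-]; exists (a + b); rewrite cappD.
- by exists (mact f a); rewrite capp_nat.
exists h => X x; have [a ax <-] := hP X (p X x).
apply/eqP; rewrite -subr_eq0 -chomB.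
by apply/eqP/pg; rewrite chomB ax subrr.
Qed.

Lemma lift_mono M N K (e : chom M N) (g : chom K N) :
  cmono e -> (forall X x, exists y, e X y = g X x) ->
  exists h : chom K M, forall X x, e X (h X x) = g X x.
Proof.
move=> em eg; apply: (@chom_of_rel K M (fun X x y => e X y = g X x)) => //.
- by move=> X x y y' <- /em.
- by move=> X x x' y y' ex ex'; rewrite !cappD ex ex'.
- by move=> X Y f x y ex; rewrite !capp_nat ex.
Qed.

Lemma chom_mono0 M N (f : chom M N) :
  (forall X x, f X x = 0 -> x = 0) -> cmono f.
Proof.
move=> f0 X x y xy; apply/eqP; rewrite -subr_eq0; apply/eqP/f0.
by rewrite chomB xy subrr.
Qed.

Section Sub.
Variables (M : cmodule C) (S : forall X, M X -> Prop).

Definition is_csub : Prop :=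
  [/\ forall X, S (0 : M X), forall X (x y : M X), S x -> S y -> S (x - y)
    & forall X Y (f : mor X Y) x, S x -> S (mact f x)].

Hypothesis hS : is_csub.

Definition csub_mem (_ : is_csub) X : {pred M X} := fun x => `[< S x >].

Lemma csub_mem_closed X : zmod_closed (@csub_mem hS X).
Proof.
have [S0 SB _] := hS; split=> [|x y /asboolP Sx /asboolP Sy]; apply/asboolP=> //.
exact: SB.
Qed.

HB.instance Definition _ X :=
  GRing.isZmodClosed.Build (M X) (@csub_mem hS X) (@csub_mem_closed X).

Lemma csub_mem_act X Y (f : mor X Y) (x : M X) :
  x \in @csub_mem hS X -> mact f x \in @csub_mem hS Y.
Proof. by have [_ _ Sa] := hS; move=> /asboolP Sx; apply/asboolP; exact: Sa. Qed.

Definition csub_of : submodule M :=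
  @Submodule C M (fun X => @csub_mem hS X) csub_mem_act.

Lemma csub_ofP X (x : M X) : reflect (S x) (x \in csub_of X).
Proof. exact: asboolP. Qed.

End Sub.

Program Definition quot_proj M (S : submodule M) : chom M (quot_module S) :=
  @Chom C _ _ (fun X x => \pi_(Quotient.quot (S X)) x) _ _.
Next Obligation. by move=> M S X x y; exact: raddfD. Qed.
Next Obligation. by move=> M S X Y f x; rewrite /= quot_act_pi. Qed.

Lemma quot_projP M (S : submodule M) X (x : M X) : quot_proj S X x = 0 <-> x \in S X.
Proof.
rewrite -(chom0 (quot_proj S) X) /=; split=> [/eqP|x0].
  by rewrite -Quotient.idealrBE subr0.
by apply: quot_eq; rewrite subr0.
Qed.

Lemma quot_proj_epi M (S : submodule M) : cepi (quot_proj S).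
Proof. by move=> X; elim/quotW=> x; exists x. Qed.

Program Definition sub_incl M (S : submodule M) : chom (sub_module S) M :=
  @Chom C _ _ (fun X x => val x) _ _.
Next Obligation. by []. Qed.
Next Obligation. by []. Qed.

Lemma sub_incl_mono M (S : submodule M) : cmono (sub_incl S).
Proof. by move=> X x y /val_inj. Qed.

Lemma is_csub_im M N (f : chom M N) : is_csub (fun X y => exists x, f X x = y).
Proof.
split=> [X|X _ _ [x <-] [y <-]|X Y h _ [x <-]].
- by exists 0; rewrite chom0.
- by exists (x - y); rewrite chomB.
- by exists (mact h x); rewrite capp_nat.
Qed.

Lemma is_csub_ker M N (f : chom M N) : is_csub (fun X x => f X x = 0).
Proof.
split=> [X|X x y fx fy|X Y h x fx]; first by rewrite chom0.
  by rewrite chomB fx fy subrr.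
by rewrite capp_nat fx mact0r.
Qed.

Lemma cokernel_exists M N (f : chom M N) :
  exists (K : cmodule C) (q : chom N K), cepi q /\ exact_at f q.
Proof.
exists (quot_module (csub_of (is_csub_im f))), (quot_proj _).
split; first exact: quot_proj_epi.
by move=> X y; rewrite quot_projP; split=> [/csub_ofP|yx] //; apply/csub_ofP.
Qed.

Program Definition elt_chom M (A : C) (x : M A) : chom (yoneda A) M :=
  @Chom C _ _ (fun X h => mact h x) _ _.
Next Obligation. by move=> M A x X f g; exact: mactDl. Qed.
Next Obligation. by move=> M A x X Y f h; exact: mact_comp. Qed.

Lemma yoneda_chomE M (A : C) (p : chom (yoneda A) M) X (h : mor A X) :
  p X h = mact h (p A (idm A)).
Proof. by rewrite -capp_nat /= compm1. Qed.

(** An exact sequence [Hom(B,-) -> Hom(A,-) -> M -> 0], expressed on elements. *)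
Definition presented_by M (A B : C) (phi : mor A B) (x : M A) : Prop :=
  (forall X y, exists h : mor A X, mact h x = y) /\
  (forall X (h : mor A X), mact h x = 0 <-> exists k : mor B X, h = mcomp k phi).

Lemma fpP M : finitely_presented M <->
  exists (A B : C) (phi : mor A B) (x : M A), presented_by phi x.
Proof.
split=> [[A [B [f [p [pe fp]]]]]|[A [B [phi [x [gen rel]]]]]].
  exists A, B, (f B (idm B)), (p A (idm A)); split=> X y.
    by have [h <-] := pe X y; exists h; rewrite -yoneda_chomE.
  rewrite -yoneda_chomE fp; split=> [[k <-]|[k ->]]; exists k.
    by rewrite yoneda_chomE.
  by rewrite yoneda_chomE.
exists A, B, (yoneda_map phi), (elt_chom x); split=> // X h.
by rewrite /= rel; split=> [[k ->]|[k <-]]; exists k.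
Qed.

Lemma fp_generated M : finitely_presented M ->
  exists (A : C) (x : M A), forall X y, exists h : mor A X, mact h x = y.
Proof. by move/fpP=> [A [B [phi [x [gen _]]]]]; exists A, x. Qed.

Lemma fp_yoneda (A : C) : finitely_presented (yoneda A).
Proof.
apply/fpP; exists A, A, 0, (idm A); split=> X h; first by exists h; rewrite /= compm1.
rewrite /= compm1; split=> [->|[k ->]]; last exact: compm0.
by exists 0; rewrite comp0m.
Qed.

End Cmodules.

(** * Finitely presented modules *)

Section AdditiveFP.
Variables (C : precat) (hadd : additive_cat C).
Implicit Types M N K : cmodule C.

Lemma additive_opcat : additive_cat (opcat C).
Proof.
case: hadd => [[Z Z0] bi]; split; first by exists Z.
move=> X Y; have [S [i [j [p [q [pi qj pj qi s]]]]]] := bi X Y.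
by exists S, p, q, i, j; split.
Qed.

(** Only a generator of [M] matters: its image, a multiple [g x] of the generator
    of [N], adds the relation [g] to those of [N]. *)
Lemma fp_cokernel M N K (f : chom M N) (q : chom N K) :
  finitely_presented M -> finitely_presented N -> cepi q -> exact_at f q ->
  finitely_presented K.
Proof.
move=> /fp_generated[A' [m mgen]] /fpP[A [B [phi [x [gen rel]]]]] qe fq; apply/fpP.
have [g gx] := gen A' (f A' m).
have [S [i [j [p [r [pi rj pj ri s]]]]]] := hadd.2 B A'.
exists A, S, (mcomp i phi + mcomp j g), (q A x); split=> [X y|X h].
  by have [z <-] := qe X y; have [h <-] := gen X z; exists h; rewrite capp_nat.
rewrite -capp_nat fq; split=> [[z zE]|[k ->]].
  have [k km] := mgen X z.
  have /rel[l lE] : mact (h - mcomp k g) x = 0.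
    by rewrite mactBl mact_comp gx -zE -km capp_nat subrr.
  exists (mcomp l p + mcomp k r); rewrite compDl !compDr !mcompA.
  rewrite -(mcompA l p i) pi compm1 -(mcompA k r j) rj compm1.
  by rewrite -(mcompA l p j) pj -(mcompA k r i) ri !compm0 !comp0m add0r addr0 -lE subrK.
exists (mact (mcomp k j) m); rewrite compDr mactDl capp_nat -gx -mact_comp !mcompA.
by rewrite (proj2 (rel _ (mcomp (mcomp k i) phi))) ?add0r //; exists (mcomp k i).
Qed.

Lemma fp_zero M : (forall X (x : M X), x = 0) -> finitely_presented M.
Proof.
move=> M0; apply/fpP; have [[Z Z0] _] := hadd.
exists Z, Z, 0, 0; split=> X h; first by exists 0; rewrite mact0l (M0 X h).
rewrite mact0r; split=> // _; exists 0.
by rewrite comp0m -[h]compm1 Z0 compm0.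
Qed.

Lemma fp_direct_sum (S M N : cmodule C) :
  is_direct_sum S M N -> finitely_presented M -> finitely_presented N ->
  finitely_presented S.
Proof.
move=> [i [j [p [q [pi qj pj qi ij]]]]] /fpP[A [B [phi [x [gen rel]]]]].
move=> /fpP[A' [B' [phi' [x' [gen' rel']]]]]; apply/fpP.
have [T [u [u' [v [v' [vu v'u' vu' v'u uv]]]]]] := hadd.2 A A'.
have [D [w [w' [z [z' [zw z'w' zw' z'w wz]]]]]] := hadd.2 B B'.
exists T, D, (mcomp w (mcomp phi v) + mcomp w' (mcomp phi' v')).
exists (i T (mact u x) + j T (mact u' x')).
have actE X (h : mor T X) : mact h (i T (mact u x) + j T (mact u' x')) =
    i X (mact (mcomp h u) x) + j X (mact (mcomp h u') x').
  by rewrite mactDr -!capp_nat !mact_comp.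
split=> [X s|X h].
  have [h hx] := gen X (p X s); have [h' hx'] := gen' X (q X s).
  exists (mcomp h v + mcomp h' v'); rewrite actE !compDl -!mcompA vu v'u' vu' v'u.
  by rewrite !compm0 !compm1 addr0 add0r hx hx' ij.
rewrite actE; split=> [h0|[k ->]].
  have /rel[k kE] : mact (mcomp h u) x = 0.
    by have := congr1 (p X) h0; rewrite cappD pi pj addr0 chom0.
  have /rel'[k' kE'] : mact (mcomp h u') x' = 0.
    by have := congr1 (q X) h0; rewrite cappD qi qj add0r chom0.
  exists (mcomp k z + mcomp k' z').
  rewrite compDl !compDr !mcompA -(mcompA k z w) -(mcompA k' z' w').
  rewrite -(mcompA k z w') -(mcompA k' z' w) zw z'w' zw' z'w !compm0 !compm1 !comp0m.
  by rewrite addr0 add0r -kE -kE' -!mcompA -compDr uv compm1.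
rewrite !compDr !compDl !mcompA -!(mcompA _ v) -!(mcompA _ v') vu v'u' vu' v'u.
rewrite !compm0 !compm1 addr0 add0r.
rewrite (proj2 (rel _ (mcomp (mcomp k w) phi))) ?chom0 ?add0r; last by eexists.
by rewrite (proj2 (rel' _ (mcomp (mcomp k w') phi'))) ?chom0 //; eexists.
Qed.

End AdditiveFP.

(** * Finite powers of a module *)

Section Power.
Variable C : precat.
Implicit Types M N K : cmodule C.

Program Definition cpower_proj n M (k : 'I_n) : chom (cpower n M) M :=
  @Chom C _ _ (fun X x => (x : {ffun 'I_n -> M X}) k) _ _.
Next Obligation. by move=> n M k X x y; rewrite /= ffunE. Qed.
Next Obligation. by move=> n M k X Y f x; rewrite /= ffunE. Qed.

Program Definition cpower_tuple n M N (f : 'I_n -> chom M N) : chom M (cpower n N) :=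
  @Chom C _ _ (fun X x => [ffun k => f k X x]) _ _.
Next Obligation.
by move=> n M N f X x y /=; apply/ffunP=> k; rewrite /= !ffunE cappD.
Qed.
Next Obligation.
by move=> n M N f X Y h x /=; apply/ffunP=> k; rewrite /= !ffunE capp_nat.
Qed.

Program Definition cpower_head n M : chom M (cpower n.+1 M) :=
  @Chom C _ _ (fun X x => [ffun k => oapp (fun=> 0) x (unlift ord0 k)]) _ _.
Next Obligation.
move=> n M X x y /=; apply/ffunP=> k; rewrite /= !ffunE.
by case: (unlift _ _) => //=; rewrite addr0.
Qed.
Next Obligation.
move=> n M X Y f x /=; apply/ffunP=> k; rewrite /= !ffunE.
by case: (unlift _ _) => //=; rewrite mact0r.
Qed.

Program Definition cpower_tail n M : chom (cpower n M) (cpower n.+1 M) :=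
  @Chom C _ _ (fun X x => [ffun k => oapp (x : {ffun 'I_n -> M X}) 0 (unlift ord0 k)]) _ _.
Next Obligation.
move=> n M X x y /=; apply/ffunP=> k; rewrite /= !ffunE.
by case: (unlift _ _) => [l|]; rewrite /= ?ffunE ?addr0.
Qed.
Next Obligation.
move=> n M X Y f x /=; apply/ffunP=> k; rewrite /= !ffunE.
by case: (unlift _ _) => [l|] /=; rewrite ?mact0r ?ffunE.
Qed.

Lemma cpowerS_direct_sum n M : is_direct_sum (cpower n.+1 M) M (cpower n M).
Proof.
exists (cpower_head n M), (cpower_tail n M), (cpower_proj M ord0).
exists (cpower_tuple (fun l => cpower_proj M (lift ord0 l))); split=> X x.
- by rewrite /= ffunE unlift_none.
- by apply/ffunP=> l; rewrite !ffunE /= !ffunE liftK.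
- by rewrite /= ffunE unlift_none.
- by apply/ffunP=> l; rewrite !ffunE /= !ffunE liftK.
apply/ffunP=> k; rewrite /= !ffunE.
by case: unliftP => [l ->|->] /=; rewrite ?ffunE ?add0r ?addr0.
Qed.

Lemma fp_cpower n M : additive_cat C -> finitely_presented M ->
  finitely_presented (cpower n M).
Proof.
move=> hadd hM; elim: n => [|n IH].
  by apply: fp_zero => // X x; apply/ffunP=> -[].
exact: fp_direct_sum (cpowerS_direct_sum n M) hM IH.
Qed.

Lemma injective_cpower n M : additive_cat C -> injective_fp M ->
  injective_fp (cpower n M).
Proof.
move=> hadd [Mfp Minj]; split=> [|K N i f Kfp Nfp im]; first exact: fp_cpower.
have [g gP] := choice (fun k => Minj K N i (comp_chom (cpower_proj M k) f) Kfp Nfp im).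
exists (cpower_tuple g) => X x; apply/ffunP=> k; rewrite /= ffunE.
exact: gP.
Qed.

Lemma in_add_cpower n M : in_add M (cpower n M).
Proof.
pose z (N : cmodule C) : chom N (cpower 0 M) := cpower_tuple (fun _ : 'I_0 => @Chom C N M (fun _ _ => 0)
  (fun _ _ _ => esym (addr0 0)) (fun _ _ f _ => esym (mact0r _ f))).
pose z' : chom (cpower 0 M) (cpower n M) := @Chom C _ _ (fun _ _ => 0)
  (fun _ _ _ => esym (addr0 0)) (fun _ _ f _ => esym (mact0r _ f)).
pose id_ : chom (cpower n M) (cpower n M) :=
  @Chom C _ _ (fun _ x => x) (fun _ _ _ => erefl) (fun _ _ _ _ => erefl).
exists n, (cpower 0 M), id_, z', id_, (z _); split=> X x //=.
- by apply/ffunP=> -[].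
by rewrite addr0.
Qed.

End Power.

(** * Consequences of the duality *)

Section Duality.
Variables (R : comPzRingType) (hR : artinian R) (E : lmodType R)
  (hE : injective_envelope_lmod (residue_lmod R) E) (C : lincat R).
Implicit Types M N K : cmodule C.

Definition mk_rdual M (X : C) (f : rval M X -> E) (hf : linear f) : rdual E M X :=
  exist _ f (asboolT hf).

Lemma rdual_linear M (X : C) (psi : rdual E M X) : linear (val psi).
Proof. exact: asboolW (valP psi). Qed.

Lemma rdual0 M (X : C) (psi : rdual E M X) : val psi 0 = 0.
Proof. exact: linear0_of (rdual_linear psi). Qed.

Lemma rdualB M (X : C) (psi : rdual E M X) (x y : M X) :
  val psi (x - y) = val psi x - val psi y.
Proof. exact: linearB_of (rdual_linear psi) x y. Qed.

Lemma rdual_separates M (X : C) (x : M X) :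
  (forall psi : rdual E M X, val psi x = 0) -> x = 0.
Proof.
move=> x0; apply: contrapT => xn0.
have [f hf fx] := cogenerator_neq0 hR hE (xn0 : (x : rval M X) <> 0).
exact: fx (x0 (mk_rdual hf)).
Qed.

Lemma csub_submod M (S : submodule M) (X : C) :
  is_submod (fun x : rval M X => (x : M X) \in S X).
Proof.
split=> [|a x y Sx Sy]; first exact: rpred0.
by apply: rpredD => //; exact: (@smem_act C M S X X).
Qed.

Lemma rval_scaleE M (X : C) (a : R) (x : rval M X) :
  a *: x = @mact C M X X (a *: lidm X) x.
Proof. by []. Qed.

Hypothesis hC : dualizing_variety E C.

Let hadd : additive_cat C. Proof. by case: hC => -[]. Qed.

(** [M] is the module whose dual is [Hom(-,A)], and [u] the element of the dual
    that corresponds to the identity of [A].  Full faithfulness of the duality and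
    the Yoneda lemma turn maps [N -> M] into forms on [N(A)]. *)
Lemma corepresenting (A : C) : exists (M : cmodule C) (u : rdual E M A),
  [/\ finitely_presented M,
      forall N (phi : rdual E N A), finitely_presented N ->
        exists f : chom N M, forall y, val phi y = val u (f A y)
    & forall X (x : M X), (forall g : mor X A, val u (mact g x) = 0) -> x = 0].
Proof.
have [_ [_ dfaith dfull ddense]] := hC.
have [M [Mfp [t [s [st ts]]]]] := ddense _ (fp_yoneda (A : opcat C)).
pose u : rdual E M A := s A (idm A).
have gen X (psi : rdual E M X) : exists g : mor X A, psi = @mact (opcat C) (cdual E M) A X g u.
  exists (t X psi); rewrite -(st X psi) ts.
  exact: (@yoneda_chomE (opcat C) _ A s X (t X psi)).
have u_eq N (f g : chom N M) : finitely_presented N ->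
    (forall y, val u (f A y) = val u (g A y)) -> eq_chom f g.
  move=> Nfp fg; apply: dfaith => // X psi; have [h ->] := gen X psi.
  rewrite !(@capp_nat (opcat C)); congr (mact _ _); apply: val_inj.
  exact/funext.
exists M, u; split=> // [N phi Nfp|X x x0].
  have [f fP] := dfull N M (comp_chom (elt_chom (phi : cdual E N A)) t) Nfp Mfp.
  have e : @mact (opcat C) (cdual E N) A A (t A u) phi = phi.
    by rewrite ts (@mact1 (opcat C) (cdual E N)).
  by exists f => y; rewrite -(etrans (fP A u) e).
have /(_ X (idm X)) : eq_chom (elt_chom x) (elt_chom (0 : M X)).
  apply: u_eq => [|g /=]; first exact: fp_yoneda.
  by rewrite x0 mact0r rdual0.
by rewrite /= mact1 mact0r.
Qed.

(** Maps to [M] are forms on values at [A], and those extend because [E] is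
    injective. *)
Lemma corepresenting_injective (A : C) (M : cmodule C) (u : rdual E M A) :
  finitely_presented M ->
  (forall N (phi : rdual E N A), finitely_presented N ->
     exists f : chom N M, forall y, val phi y = val u (f A y)) ->
  (forall X (x : M X), (forall g : mor X A, val u (mact g x) = 0) -> x = 0) ->
  injective_fp M.
Proof.
move=> Mfp uex uinj; split=> // N K i f Nfp Kfp im.
have hi : linear (fun y : rval N A => i A y : rval K A) := @chom_linear R C N K i A.
have hf : linear (fun y : rval N A => val u (f A y)).
  exact: linear_comp (@chom_linear R C N M f A) (rdual_linear u).
have [g hg gE] := injective_extend hE hi (im A) hf.
have [h hE'] := uex K (mk_rdual hg) Kfp.
exists h => X x /=; apply/eqP; rewrite -subr_eq0; apply/eqP/uinj => k.
by rewrite mactB rdualB -!capp_nat -hE' /= gE subrr.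
Qed.

(** The cokernel of the dual map is the dual of some [M]; as [E] is an injective
    cogenerator, dualizing back makes [M] the kernel. *)
Lemma kernel_fp N K (f : chom N K) : finitely_presented N -> finitely_presented K ->
  exists (M : cmodule C) (k : chom M N),
    [/\ finitely_presented M, cmono k & exact_at k f].
Proof.
move=> Nfp Kfp; have [_ [dfp _ dfull ddense]] := hC.
have [Q [q [qe qf]]] := cokernel_exists (dual_map E f).
have Qfp := fp_cokernel (additive_opcat hadd) (dfp _ Kfp) (dfp _ Nfp) qe qf.
have [M [Mfp [t [s [st ts]]]]] := ddense _ Qfp.
have [k kP] := dfull M N (comp_chom s q) Mfp Nfp.
have kE X (psi : rdual E N X) x :
    val psi (k X x) = val (s X (q X psi) : rdual E M X) x.
  by have e := congr1 (fun v : rdual E M X => val v x) (kP X psi).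
exists M, k; split=> //.
  apply: chom_mono0 => X x kx; apply: rdual_separates => psi.
  have [psi' psiE] := qe X (t X psi).
  by have := kE X psi' x; rewrite psiE st kx rdual0.
move=> X y; split=> [fy|[x <-]].
  apply: contrapT => nky.
  have [psi [hpsi psi0 psiy]] := cogenerator hR hE
    (csub_submod (csub_of (is_csub_im k)) X) (fun h => nky (csub_ofP _ _ h)).
  pose psi' := mk_rdual hpsi.
  have /qf[phi phiE] : q X psi' = 0.
    rewrite -(ts X (q X psi')); have -> : s X (q X psi') = 0; last exact: chom0.
    apply: val_inj; apply/funext => x; rewrite -kE; apply: psi0.
    by apply/csub_ofP; exists x.
  by apply: psiy; rewrite -[psi]/(val psi') -phiE /= fy rdual0.
apply: rdual_separates => psi.
have := kE X (dual_map E f X psi) x; rewrite /= => ->.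
have -> : q X (dual_app f psi) = 0 by apply/(qf X); exists psi.
by rewrite (@chom0 (opcat C)).
Qed.

(** A generator of the dual of [N] over [A] gives a map to the module
    corepresenting [A], injective because the multiples of the generator are all
    the forms on [N]. *)
Lemma enough_injectives N : finitely_presented N ->
  exists (M : cmodule C) (f : chom N M), injective_fp M /\ cmono f.
Proof.
move=> Nfp; have [_ [dfp _ _ _]] := hC.
have [A [z zgen]] := fp_generated (dfp _ Nfp).
have [M [u [Mfp uex uinj]]] := corepresenting A.
have [f fP] := uex N z Nfp.
exists M, f; split; first exact: corepresenting_injective uex uinj.
apply: chom_mono0 => X x fx; apply: rdual_separates => psi.
have [g <-] := zgen X psi.
by rewrite /= fP capp_nat fx mact0r rdual0.
Qed.

Lemma image_fp N K (f : chom N K) : finitely_presented N -> finitely_presented K ->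
  exists (M : cmodule C) (p : chom N M) (i : chom M K),
    [/\ finitely_presented M, cepi p, cmono i & forall X x, i X (p X x) = f X x].
Proof.
move=> Nfp Kfp; have [L [k [Lfp km kf]]] := kernel_fp f Nfp Kfp.
have [M [p [pe kp]]] := cokernel_exists k.
have [X x|i iE] := @factor_epi _ _ _ _ p f pe; first by rewrite kp -kf.
exists M, p, i; split=> //; first exact: fp_cokernel Lfp Nfp pe kp.
by apply: chom_mono0 => X y; have [x <-] := pe X y; rewrite iE kf -kp.
Qed.

Lemma hom_dcc (A B : C) : dcc (mor A B : lmodType R).
Proof.
have [[_ _ hfin] _] := hC; have [n [g gP]] := hfin A B.
apply: (spanned_dcc hR (s := [seq g i | i <- enum 'I_n])) => v.
by have [a ->] := gP v; exact: in_span_sum.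
Qed.

Lemma fp_dcc M (X : C) : finitely_presented M -> dcc (rval M X).
Proof.
move=> /fp_generated[A [x xgen]]; have [[_ _ hfin] _] := hC.
have [n [g gP]] := hfin A X.
pose h (f : lhom A X) : rval M X := @mact C M A X f x.
have hh : linear h.
  move=> a f f'; rewrite /h mactDl; congr (_ + _).
  by rewrite rval_scaleE -mact_comp /= lcompZl lcomp1m.
apply: (spanned_dcc hR (s := [seq h (g i) | i <- enum 'I_n])) => v.
have [f <-] := xgen X v; have [a ->] := gP f.
rewrite -/(h _) (linear_combination_of _ _ _ hh).
exact: (in_span_sum (h \o g)).
Qed.

End Duality.

(** * The trace ideal and torsion elements *)

Section Torsion.
Variables (C : precat) (c : C).
Implicit Types M N K : cmodule C.

Notation I := (trace_ideal (yoneda c)).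

Lemma traceP (X Y : C) (f : mor X Y) : f \in I X Y <->
  exists s : seq (mor X c * mor c Y), f = \sum_(t <- s) mcomp t.2 t.1.
Proof.
split=> [/asboolP[s ->]|[s ->]].
  exists [seq (t.1 c (idm c), t.2) | t : chom (yoneda c) (yoneda X) * yoneda c Y <- s].
  by rewrite big_map; apply: eq_bigr => t _; rewrite yoneda_chomE.
apply/asboolP; exists [seq (yoneda_map t.1, t.2) | t <- s].
by rewrite big_map.
Qed.

Lemma mem_trace (X Y : C) (f : mor X c) (g : mor c Y) : mcomp g f \in I X Y.
Proof. by apply/traceP; exists [:: (f, g)]; rewrite big_seq1. Qed.

Lemma mem_trace_to (X : C) (f : mor X c) : f \in I X c.
Proof. by rewrite -[f]comp1m; exact: mem_trace. Qed.

Definition torsion M (X : C) (x : M X) : Prop := forall f : mor X c, mact f x = 0.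

Definition torsion_free M : Prop := forall X (x : M X), torsion x -> x = 0.

(** [D] is a retract of a finite power of [c]. *)
Definition in_addc (D : C) : Prop := idm D \in I D D.

Lemma torsion_trace M (X Y : C) (x : M X) (f : mor X Y) :
  torsion x -> f \in I X Y -> mact f x = 0.
Proof.
move=> xt /traceP[s ->]; rewrite mact_suml big1 // => t _.
by rewrite mact_comp xt mact0r.
Qed.

Lemma torsion_addc M (D : C) (x : M D) : in_addc D -> torsion x -> x = 0.
Proof. by move=> hD xt; rewrite -[x]mact1; exact: torsion_trace hD. Qed.

Lemma torsion_at_c M (x : M c) : torsion x -> x = 0.
Proof. by move/(_ (idm c)); rewrite mact1. Qed.

Lemma torsion_chom M N (h : chom M N) (X : C) (x : M X) : torsion x -> torsion (h X x).
Proof. by move=> xt g; rewrite -capp_nat xt chom0. Qed.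

Lemma torsion_free_mono M N (h : chom M N) : cmono h -> torsion_free N -> torsion_free M.
Proof.
by move=> hm Nt X x /torsion_chom-/(_ _ h) /Nt hx; apply: hm; rewrite hx chom0.
Qed.

Lemma torsion_free_cpower n M : torsion_free M -> torsion_free (cpower n M).
Proof.
move=> Mt X x xt; apply/ffunP=> k; rewrite ffunE.
exact/Mt/(torsion_chom (cpower_proj M k) xt).
Qed.

Lemma torsion_free_in_add M N : in_add M N -> torsion_free M -> torsion_free N.
Proof.
move=> [n [N' [i [_ [p [_ [pi _ _ _ _]]]]]]] /(torsion_free_cpower (n := n)).
by apply: torsion_free_mono (i) _ => X x y /(congr1 (p X)); rewrite !pi.
Qed.

End Torsion.

Section Approximation.
Variables (R : comPzRingType) (C : lincat R) (hvar : hom_finite_variety C) (c : C).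

Notation I := (trace_ideal (yoneda c)).

(** Objects of [C] have finite direct sums: collect the maps [X -> c] of the list
    into one map to a power of [c]. *)
Lemma approximation_seq (X : C) (s : seq (mor X c)) :
  exists (D : C) (alpha : mor X D), in_addc c D /\
    forall g, g \in s -> exists k : mor D c, g = mcomp k alpha.
Proof.
have [[[Z Z0] bi] _ _] := hvar.
elim: s => [|g s [D [alpha [hD IH]]]].
  by exists Z, 0; split=> //; rewrite /in_addc Z0 rpred0.
have [S [i [j [p [q [pi qj pj qi ij]]]]]] := bi D c.
exists S, (mcomp i alpha + mcomp j g); split=> [|f].
  rewrite /in_addc -ij rpredD //; last exact: mem_trace.
  by apply: imem_l; rewrite -[p]comp1m; exact: imem_r.
rewrite inE => /predU1P[->|/IH[k ->]].
  by exists q; rewrite compDr !mcompA qi qj comp0m comp1m add0r.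
exists (mcomp k p); rewrite compDr !mcompA -!(mcompA k p) pi pj.
by rewrite compm1 compm0 comp0m addr0.
Qed.

Lemma approximation (X : C) :
  exists (D : C) (alpha : mor X D),
    [/\ in_addc c D, alpha \in I X D &
      forall Y (f : mor X Y), f \in I X Y -> exists k : mor D Y, f = mcomp k alpha].
Proof.
have [_ _ hfin] := hvar; have [n [g gP]] := hfin X c.
have [D [alpha [hD hs]]] := approximation_seq [seq g i | i <- enum 'I_n].
have fac (f : mor X c) : exists k : mor D c, f = mcomp k alpha.
  have kex i : exists k : mor D c, g i = mcomp k alpha.
    by apply: hs; apply: map_f; rewrite mem_enum.
  have [k kE] := choice kex; have [a ->] := gP f.
  exists (\sum_i (a i *: (k i : lhom D c)) : lhom D c).
  rewrite comp_suml; apply: eq_bigr => i _.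
  by rewrite kE /= lcompZl.
exists D, alpha; split=> //.
  by rewrite -(comp1m alpha); apply: imem_r.
move=> Y f /traceP[s ->].
have [k kE] := choice fac.
exists (\sum_(t <- s) mcomp t.2 (k t.1)); rewrite comp_suml.
by apply: eq_bigr => t _; rewrite -mcompA -kE.
Qed.

End Approximation.

(** * The injective envelope of P/rad(P) *)

Section Envelope.
Variables (R : comPzRingType) (hR : artinian R) (E : lmodType R)
  (hE : injective_envelope_lmod (residue_lmod R) E) (C : lincat R)
  (hC : dualizing_variety E C) (c : C) (J : cmodule C)
  (hJ : injective_envelope_fp (quot_module (cmod_rad (yoneda c))) J).
Implicit Types M N K Y : cmodule C.

Let hadd : additive_cat C. Proof. by case: hC => -[]. Qed.

Notation P := (yoneda c).

(** Otherwise the elements of [P] that are multiples of [h] modulo [S] would form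
    a proper submodule larger than [S]. *)
Lemma maximal_sub_unit (S : submodule P) (X : C) (h : mor c X) :
  maximal_sub S -> h \notin S X -> exists g : mor X c, idm c - mcomp g h \in S c.
Proof.
move=> [_ Smax] hS.
have Ks : is_csub (fun Z (k : P Z) => exists g : mor X Z, k - mcomp g h \in S Z).
  split=> [Z|Z k k' [g gk] [g' gk']|Z T f k [g gk]].
  - by exists 0; rewrite comp0m subr0 rpred0.
  - by exists (g - g'); rewrite compBl opprD opprK addrACA (addrC (- k')) -[X in _ + X]opprB rpredB.
  - by exists (mcomp f g); rewrite -mcompA -[X in X - _]/(mcomp f k) -compBr; exact: (smem_act f gk).
apply: contrapT => nid.
have Smax_ : forall Z, csub_of Ks Z =i S Z.
  apply: Smax.
    by move=> Z k kS; apply/csub_ofP; exists 0; rewrite comp0m subr0.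
  by exists c, (idm c); apply/negP=> /csub_ofP.
case/negP: hS; rewrite -Smax_; apply/csub_ofP; exists (idm X).
by rewrite comp1m subrr rpred0.
Qed.

Lemma maximal_sub_id (S : submodule P) : maximal_sub S -> idm c \notin S c.
Proof.
move=> [[X [h hS]] _]; apply: contra hS => idS.
by rewrite -[h]compm1; exact: (smem_act h idS).
Qed.

(** Dividing [J] by the submodule of a nonzero torsion [x] must, by essentiality,
    kill a nonzero class of some [h] in [P/rad(P)].  Being torsion, that class has
    [g h] in the radical for all [g], whereas [h] outside a maximal submodule
    makes some [id - g h] belong to it. *)
Lemma envelope_torsion_free : torsion_free c J.
Proof.
have [[Jfp _] [j [jm jess]]] := hJ.
move=> X x xt.
have [K [q [qe qx]]] := cokernel_exists (elt_chom x).
have Kfp := fp_cokernel hadd (fp_yoneda X) Jfp qe qx.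
have qm : cmono q.
  apply: jess => //; apply: chom_mono0 => Y; elim/quotW=> h /=.
  rewrite -[X in j Y X]/(quot_proj (cmod_rad P) Y h) qx => -[f fx].
  apply/(quot_projP (cmod_rad P))/asboolP => S Smax; apply: contrapT => /negP hS.
  have [g gS] := maximal_sub_unit Smax hS.
  case/negP: (maximal_sub_id Smax); rewrite -(subrK (mcomp g h) (idm c)) rpredD //.
  suff : mcomp g h \in cmod_rad P c by move/asboolP; exact.
  apply/(quot_projP (cmod_rad P)); apply: jm; rewrite chom0.
  rewrite -[mcomp g h]/(@mact C P _ _ g h) !capp_nat -fx /= -mact_comp.
  exact: xt.
apply: qm; rewrite chom0; apply/qx; exists (idm X); exact: mact1.
Qed.

(** A multiple of [m] by endomorphisms of [c] that generates a simple
    [End(c)]-module: such a multiple exists since [M(c)] has the descending chain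
    condition. *)
Lemma simple_image M (m : M c) : finitely_presented M -> torsion_free c M -> m <> 0 ->
  exists2 e : mor c c, mact e m <> 0 &
    forall f : mor c c, mact f (mact e m) <> 0 ->
      exists g : mor c c, mact e m = mact g (mact f (mact e m)).
Proof.
move=> Mfp Mt m0; pose A (e : mor c c) : rval M c -> Prop := fun y =>
  exists g : mor c c, y = mact g (mact e m) :> M c.
have As e : is_submod (A e).
  split=> [|a _ _ [g ->] [g' ->]]; first by exists 0; rewrite mact0l.
  exists ((a *: (g : lhom c c) : lhom c c) + g'); rewrite mactDl; congr (_ + _).
  by rewrite rval_scaleE -mact_comp /= lcompZl lcomp1m.
pose Q S := exists2 e : mor c c, mact e m <> 0 & S = A e.
have [_ [e _ ->] //||_ [[e e0 ->] Smin]] := dcc_minimal (fp_dcc hR hC (X := c) Mfp) (Q := Q).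
  by exists (A (idm c)), (idm c) => //; rewrite mact1.
exists e => // f fe0.
have [|||g gE] := Smin (A (mcomp f e)) _ _ (mact e m).
- by exists (mcomp f e) => //; rewrite mact_comp.
- by move=> _ [g ->]; exists (mcomp g f); rewrite -!mact_comp mcompA.
- by exists (idm c); rewrite mact1.
by exists g; rewrite -[mact f _]mact_comp.
Qed.

(** A simple quotient [P/S] embeds in [P/rad(P)].  Take [T] not contained in [S]
    with [T(c)] minimal; then the intersection of [T] and [S] lies in every
    maximal submodule, and for a decomposition [id = t + s] along [T] and [S]
    right multiplication by [t] induces the embedding. *)
Lemma maximal_sub_complement (S : submodule P) : maximal_sub S ->
  exists2 t : mor c c, t \notin cmod_rad P c &
    forall X (h : mor c X), h \in S X -> mcomp h t \in cmod_rad P X.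
Proof.
move=> Smax; have idS := maximal_sub_id Smax.
pose Q (A : (mor c c : lmodType R) -> Prop) := exists T : submodule P,
  (exists X (h : mor c X), h \in T X /\ h \notin S X) /\ A = (fun e => e \in T c).
have Tsub (T : submodule P) : @is_submod R (mor c c : lmodType R) (fun e => e \in T c).
  split=> [|a x y xT yT]; first exact: rpred0.
  apply: rpredD => //; have := @smem_act C P T c c (a *: lidm c : lhom c c) x xT.
  by rewrite /= lcompZl lcomp1m.
have [_ [T [_ ->]] //||_ [[T [[X [h [hT hS]]] ->]] Tmin]] :=
  dcc_minimal (hom_dcc hR hC (A := c) (B := c)) (Q := Q).
  have allP : is_csub (fun (X : C) (_ : P X) => True) by [].
  exists (fun e => e \in csub_of allP c), (csub_of allP); split=> //.
  by exists c, (idm c); split=> //; apply/(csub_ofP allP).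
have {X h hT hS} [t [tT sS]] : exists t : mor c c, t \in T c /\ idm c - t \in S c.
  have [g gS] := maximal_sub_unit Smax hS; exists (mcomp g h); split=> //.
  exact: (smem_act g hT).
have tS : t \notin S c.
  by apply: contra idS => tS; rewrite -(subrK t (idm c)) rpredD.
have TSrad X (k : mor c X) : k \in T X -> k \in S X -> k \in cmod_rad P X.
  move=> kT kS; apply/asboolP => S' S'max; apply: contrapT => /negP kS'.
  have [g gS'] := maximal_sub_unit S'max kS'.
  have T's : is_csub (fun Z (l : P Z) => l \in T Z /\ l \in S' Z).
    split=> [Z|Z l l' [? ?] [? ?]|Z W f l [? ?]]; rewrite ?rpred0 ?rpredB //.
    by split; apply: smem_act.
  have [T'S|nT'S] := pselect (forall Z (l : mor c Z), l \in T Z -> l \in S' Z -> l \in S Z).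
    case/negP: tS; rewrite -[t]compm1 -(subrK (mcomp g k) (idm c)) compDr rpredD //.
      apply: T'S; last exact: (smem_act t gS').
      rewrite compBr compm1 rpredB // mcompA; exact: (smem_act (mcomp t g) kT).
    by rewrite mcompA; exact: (smem_act (mcomp t g) kS).
  have QT' : Q (fun e => e \in csub_of T's c).
    exists (csub_of T's); split=> //; apply: contrapT => nex; apply: nT'S => Z l lT lS'.
    apply: contrapT => /negP lS; apply: nex; exists Z, l; split=> //.
    exact/(csub_ofP T's).
  have /(csub_ofP T's)[_ gkS'] : mcomp g k \in csub_of T's c.
    apply: (Tmin _ QT') => [v /(csub_ofP T's)[] //|]; exact: (smem_act g kT).
  case/negP: (maximal_sub_id S'max).
  by rewrite -(subrK (mcomp g k) (idm c)) rpredD.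
exists t => [|X h hS].
  by apply: contra tS => /asboolP; exact.
apply: TSrad; first exact: (smem_act h tT).
rewrite -[mcomp h t](subKr h) rpredB // -[X in X - _]compm1 -compBr.
exact: (smem_act h sS).
Qed.

(** In the module [M] corepresenting [c], a nonzero image of [x] has a multiple [m]
    generating a simple module [P/S].  It embeds in [P/rad(P)], hence in [J], and
    injectivity of [J] extends this to [M]. *)
Lemma envelope_separates Y (x : Y c) : finitely_presented Y -> x <> 0 ->
  exists g : chom Y J, g c x <> 0.
Proof.
move=> Yfp x0.
have [psi psix] : exists psi : rdual E Y c, val psi x <> 0.
  apply: contrapT => npsi; apply: x0; apply: (rdual_separates hR hE) => psi.
  by apply: contrapT => psix; apply: npsi; exists psi.
have [M [u [Mfp uex uinj]]] := corepresenting hC c.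
have [f fP] := uex Y psi Yfp.
have fx0 : f c x <> 0 by move=> fx; apply: psix; rewrite fP fx rdual0.
have Mt : torsion_free c M.
  by move=> X y yt; apply: uinj => g; rewrite yt rdual0.
have [e] := simple_image Mfp Mt fx0; set m := mact e _ => m0 msimple.
suff [g gm] : exists g : chom M J, g c m <> 0.
  exists (comp_chom g f) => gfx; apply: gm.
  by rewrite /m capp_nat; move: gfx => /= ->; rewrite mact0r.
pose S : submodule P := csub_of (is_csub_ker (elt_chom m)).
have SP X (h : mor c X) : h \in S X <-> mact h m = 0.
  by split=> [/(csub_ofP (is_csub_ker _))|hm] //; apply/(csub_ofP (is_csub_ker (elt_chom m))).
have Smax : maximal_sub S.
  split=> [|T ST [X [h hT]] Z k]; first by exists c, (idm c); apply/negP=> /SP; rewrite mact1.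
  apply/idP/idP=> [kT|/ST //]; apply/SP/Mt => g.
  apply: contrapT; rewrite -mact_comp => /msimple[l lE].
  case/negP: hT; rewrite -[h]compm1; apply: (@smem_act C P T c X h (idm c)).
  rewrite -(subrK (mcomp l (mcomp g k)) (idm c)) rpredD //.
    by apply/ST/SP; rewrite mactBl mact1 mact_comp -lE subrr.
  by rewrite mcompA; exact: (smem_act (mcomp l g) kT).
have [t trad tS] := maximal_sub_complement Smax.
have [[Jfp Jinj] [j [jm _]]] := hJ.
pose b := elt_chom (j c (quot_proj (cmod_rad P) c t)).
have bE X (h : mor c X) : b X h = j X (quot_proj (cmod_rad P) X (mcomp h t)).
  by rewrite -[LHS]/(mact h (j c (quot_proj (cmod_rad P) c t))) -!capp_nat.
have [G [p [i [Gfp pe im ip]]]] := image_fp hR hE hC (elt_chom m) (fp_yoneda c) Mfp.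
have [X h ph|h hp] := @factor_epi _ _ _ _ p b pe.
  have /SP/tS/(quot_projP (cmod_rad P)) : mact h m = 0 by rewrite -[LHS](ip X h) ph chom0.
  by rewrite bE => ->; exact: chom0.
have [g gE] := Jinj G M i h Gfp Mfp im.
exists g => gm; case/negP: trad; apply/(quot_projP (cmod_rad P))/jm.
rewrite chom0 -[t]comp1m -bE -hp -gE /= ip /= mact1.
exact: gm.
Qed.

(** By the descending chain condition on [Y(c)], finitely many maps to [J]
    suffice to separate the elements of [Y(c)], and a torsion element is one with
    no nonzero multiple there. *)
Lemma torsion_kernel Y : finitely_presented Y ->
  exists n (g : chom Y (cpower n J)), forall X y, g X y = 0 <-> torsion c y.
Proof.
move=> Yfp.
pose Q (A : rval Y c -> Prop) := exists n (g : chom Y (cpower n J)),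
  A = (fun x => g c x = 0).
have [_ [n [g ->]]||_ [[n [g ->]] gmin]] := dcc_minimal (fp_dcc hR hC (X := c) Yfp) (Q := Q).
- split=> [|a x y gx gy]; first exact: chom0.
  by rewrite cappD gy addr0 capp_nat gx mact0r.
- pose z k : chom Y J := False_rect _ (notF (ltn_ord (k : 'I_0))).
  by exists (fun x => cpower_tuple z c x = 0), 0%N, (cpower_tuple z).
have gc (x : Y c) : g c x = 0 -> x = 0.
  move=> gx; apply: contrapT => x0; have [g' g'x] := envelope_separates Yfp x0.
  (* adjoin the separating map [g'] as a further coordinate *)
  pose g1 : chom Y (cpower n.+1 J) := cpower_tuple (fun k =>
    oapp (fun l => comp_chom (cpower_proj J l) g) g' (unlift ord0 k)).
  have Qg1 : Q (fun y => g1 c y = 0) by exists n.+1, g1.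
  have g1g (y : Y c) : g1 c y = 0 -> g c y = 0.
    move=> g1y; apply/ffunP=> l; have := congr1 (cpower_proj J (lift ord0 l) c) g1y.
    by rewrite chom0 /= !ffunE liftK.
  have := congr1 (cpower_proj J ord0 c) (gmin _ Qg1 g1g x gx).
  rewrite chom0 /= !ffunE unlift_none.
  exact: g'x.
exists n, g => X y; split=> [gy f|yt].
  by apply: gc; rewrite capp_nat gy mact0r.
exact/(torsion_free_cpower envelope_torsion_free)/torsion_chom.
Qed.

End Envelope.

(** * Coresolutions *)

Section Coresolution.
Variable C : precat.

(** A map of a coresolution together with its ends, so that a coresolution can be
    built by recursion on a single type. *)
Record arrow := Arrow { src : cmodule C; tgt : cmodule C; arr : chom src tgt }.

Variable W : nat -> arrow -> Prop.

Hypothesis W_step : forall n a, W n a ->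
  exists (B : cmodule C) (d : chom (tgt a) B), W n.+1 (Arrow d) /\ exact_at (arr a) d.

(** The recursion is arranged so that the target of each map is, by computation,
    the source of the next one. *)
Lemma coresolution_exists (a : arrow) (Y : cmodule C) (e : chom Y (src a)) :
  W 0 a -> cmono e -> exact_at e (arr a) ->
  exists (I : nat -> cmodule C) (e : chom Y (I 0%N)) (d : forall i, chom (I i) (I i.+1)),
    [/\ cmono e, exact_at e (d 0%N), forall i, exact_at (d i) (d i.+1)
      & forall i, W i (Arrow (d i))].
Proof.
move=> Wa em ea.
pose st n := {a : arrow | W n a}.
have nextP n (s : st n) := cid (W_step (svalP s)).
pose nextd n (s : st n) := cid (projT2 (nextP n s)).
pose next n (s : st n) : st n.+1 :=
  exist _ (Arrow (projT1 (nextd n s))) (projT2 (nextd n s)).1.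
pose fix s n : st n := if n is n'.+1 then next n' (s n') else exist _ a Wa.
exists (fun n => src (sval (s n))), e.
exists (fun n => arr (sval (s n)) : chom (src (sval (s n))) (src (sval (s n.+1)))).
split=> // i; first exact: (projT2 (nextd i (s i))).2.
have eta n b : W n b -> W n (Arrow (arr b)) by case: b.
exact: eta (svalP (s i)).
Qed.

End Coresolution.

(** * Projectivity of I(X,-) *)

Section Projectivity.
Variables (R : comPzRingType) (C : lincat R) (hvar : hom_finite_variety C) (c : C).
Implicit Types M N : cmodule C.

Notation I := (trace_ideal (yoneda c)).

Definition ideal_elt (X Y : C) (f : mor X Y) (fI : f \in I X Y) : ideal_at I X Y :=
  exist _ f fI.

(** [eps] is a reflection of [X] in add(c), which identifies [Hom(D,-)] with
    [I(X,-)]. *)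
Definition reflection (X D : C) (eps : mor X D) : Prop :=
  [/\ in_addc c D, eps \in I X D,
      forall Y (f : mor X Y), f \in I X Y -> exists k : mor D Y, f = mcomp k eps
    & forall Y (k : mor D Y), mcomp k eps = 0 -> k = 0].

(** The epimorphism [Hom(D,-) -> I(X,-)] given by an approximation splits, so
    [I(X,-)] is the image of an idempotent of [D], and idempotents split in [C]. *)
Lemma reflection_exists (X : C) : cprojective (ideal_at I X) ->
  exists (D : C) (eps : mor X D), reflection eps.
Proof.
move=> Iproj; have [D [alpha [hD aI afac]]] := approximation hvar c X.
pose p := elt_chom (ideal_elt aI).
pose id_ : chom (ideal_at I X) (ideal_at I X) :=
  @Chom C _ _ (fun _ x => x) (fun _ _ _ => erefl) (fun _ _ _ _ => erefl).
have [|s sP] := Iproj _ _ p id_.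
  move=> Y [f fI]; have [k fk] := afac Y f fI; exists k.
  by apply: val_inj; exact: esym.
have sE Y (f : mor X Y) (fI : f \in I X Y) : mcomp (s Y (ideal_elt fI)) alpha = f.
  by have := congr1 (fun z : ideal_at I X Y => val z) (sP Y (ideal_elt fI)).
pose e := s D (ideal_elt aI); have ea : mcomp e alpha = alpha by exact: sE.
have sk Y (k : mor D Y) : s Y (mact k (ideal_elt aI)) = mcomp k e.
  exact: capp_nat.
have ee : mcomp e e = e.
  by rewrite -sk; congr (s D _); apply: val_inj; exact: ea.
have [_ split _] := hvar; have [D' [r [i [ri ir]]]] := split D e ee.
exists D', (mcomp r alpha); split.
- rewrite /in_addc -ri -[i]comp1m; apply: imem_l; exact: imem_r.
- exact: imem_l.
- move=> Y f /afac[k ->]; exists (mcomp k i).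
  by rewrite !mcompA -(mcompA k) ir -mcompA ea.
move=> Y k kra; have : mcomp (mcomp k r) e = 0.
  rewrite -sk -(chom0 s Y); congr (s Y _); apply: val_inj.
  by have : mcomp (mcomp k r) alpha = 0 by rewrite -mcompA.
rewrite -ir !mcompA -(mcompA k r i) ri compm1 => kr.
by rewrite -[k]compm1 -ri mcompA kr comp0m.
Qed.

(** [k alpha |-> k sigma] is a well defined section of the epimorphism
    [Hom(D,-) -> I(X,-)]. *)
Lemma projective_of_retraction (X D : C) (alpha : mor X D) (sigma : mor D D) :
  alpha \in I X D ->
  (forall Y (f : mor X Y), f \in I X Y -> exists k : mor D Y, f = mcomp k alpha) ->
  mcomp sigma alpha = alpha ->
  (forall Y (f : mor D Y), mcomp f alpha = 0 -> mcomp f sigma = 0) ->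
  cprojective (ideal_at I X).
Proof.
move=> aI afac sa s0 M N g f gepi.
have [m gm] := gepi D (f D (ideal_elt aI)).
pose Q Y (x : ideal_at I X Y) (z : M Y) := exists2 k : mor D Y,
  val x = mcomp k alpha & z = mact (mcomp k sigma) m.
have [||||h hP] := @chom_of_rel C (ideal_at I X) M Q.
- move=> Y [x xI]; have [k xk] := afac Y x xI.
  by exists (mact (mcomp k sigma) m); exists k.
- move=> Y x _ _ [k xk ->] [k' xk' ->]; apply/eqP; rewrite -subr_eq0 -mactBl -compBl.
  by rewrite s0 ?mact0l // compBl -xk -xk' subrr.
- move=> Y x x' _ _ [k xk ->] [k' xk' ->]; exists (k + k'); last by rewrite compDl mactDl.
  by rewrite compDl; exact: congr2 xk xk'.
- move=> Y Z u x _ [k xk ->]; exists (mcomp u k); last by rewrite -mact_comp mcompA.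
  by rewrite -mcompA; have e := congr1 (fun z : mor X Y => mcomp u z) xk; exact: e.
exists h => Y x; have [k xk hx] := hP Y x; rewrite /= hx capp_nat gm -capp_nat.
congr (f Y _); apply: val_inj.
rewrite [RHS]xk; transitivity (mcomp (mcomp k sigma) alpha) => //.
by rewrite -mcompA sa.
Qed.

End Projectivity.

(** * Coresolutions by add(J) *)

Section AddJ.
Variables (R : comPzRingType) (hR : artinian R) (E : lmodType R)
  (hE : injective_envelope_lmod (residue_lmod R) E) (C : lincat R)
  (hC : dualizing_variety E C) (c : C) (J : cmodule C)
  (hJ : injective_envelope_fp (quot_module (cmod_rad (yoneda c))) J).
Implicit Types M N K Y : cmodule C.

Notation I := (trace_ideal (yoneda c)).

Let hadd : additive_cat C. Proof. by case: hC => -[]. Qed.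

Let Jt : torsion_free c J. Proof. exact: (envelope_torsion_free hC hJ). Qed.

Let in_add_tf M : in_add J M -> torsion_free c M.
Proof. by move=> Madd; exact: (torsion_free_in_add Madd Jt). Qed.

(** The cokernel of a map of add(J) is torsion-free, because torsion of the
    cokernel lifts along a reflection; so it embeds in a power of [J] and the
    coresolution goes on. *)
Lemma II_one_infinite Y :
  (forall X, cprojective (ideal_at I X)) -> II J (Some 1%N) Y -> II J None Y.
Proof.
move=> Iproj [Yfp [Q [e [d [em ed dd Qinj Qadd]]]]]; split=> //.
pose W (n : nat) (a : arrow C) := [/\ injective_fp (src a), injective_fp (tgt a),
  in_add J (src a) & in_add J (tgt a)].
have step n a : W n a ->
    exists (B : cmodule C) (d : chom (tgt a) B), W n.+1 (Arrow d) /\ exact_at (arr a) d.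
  case: a => A B f [/= Ainj Binj Aadd Badd].
  have [K [q [qe fq]]] := cokernel_exists f.
  have Kfp := fp_cokernel hadd Ainj.1 Binj.1 qe fq.
  have Kt : torsion_free c K.
    move=> X x; have [y <-] := qe X x => yt.
    have [D [eps [hD eI efac einj]]] := reflection_exists hC.1 (Iproj X).
    have /fq[z zE] : q D (mact eps y) = 0 by rewrite capp_nat (torsion_trace yt).
    have epsm : cmono (yoneda_map eps).
      by apply: chom_mono0 => Z k; exact: einj.
    have [g gE] := Ainj.2 _ _ _ (elt_chom z) (fp_yoneda D) (fp_yoneda X) epsm.
    apply/fq; exists (g X (idm X)); apply/eqP; rewrite -subr_eq0; apply/eqP.
    apply: (in_add_tf Badd) => h.
    have [k ->] := efac _ h (mem_trace_to h).
    rewrite mact_comp mactB -zE -capp_nat -yoneda_chomE.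
    have gz : g D (mcomp (idm D) eps) = mact (idm D) z by exact: gE.
    rewrite comp1m mact1 in gz.
    by rewrite gz subrr mact0r.
  have [n' [g gP]] := torsion_kernel hR hE hC hJ Kfp.
  exists (cpower n' J), (comp_chom g q); split.
    split=> //; last exact: in_add_cpower.
    by apply: injective_cpower => //; case: hJ.
  move=> X y; rewrite -fq /= gP; split=> [/Kt //|->].
  by move=> h; rewrite mact0r.
have W0 : W 0%N (Arrow (d 0%N)) by split=> //=; exact: Qadd.
have [Q' [e' [d' [em' ed' dd' W']]]] := coresolution_exists step W0 em ed.
exists Q', e', d'; split=> // i; first by case: (W' i).
by move=> _; case: (W' i).
Qed.

(** With [J_0] and [J_1] the powers of [J] that receive [L] and the cokernel of
    [L -> J_0], both modulo torsion, [Y] is the kernel of [J_0 -> J_1].  The cokernel of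
    [L -> Y] is the torsion of the cokernel of [L -> J_0], which add(c) does not
    see. *)
Lemma torsion_closure L : finitely_presented L ->
  exists (Y : cmodule C) (a : chom L Y), [/\ II J (Some 1%N) Y,
    forall X x, a X x = 0 -> torsion c x &
    forall D, in_addc c D -> forall y : Y D, exists x, a D x = y].
Proof.
move=> Lfp; have [n [g gP]] := torsion_kernel hR hE hC hJ Lfp.
have [[Jfp _] _] := hJ.
have Jn_inj m : injective_fp (cpower m J) by apply: injective_cpower => //; case: hJ.
have [Z [q [qe gq]]] := cokernel_exists g.
have Zfp := fp_cokernel hadd Lfp (Jn_inj n).1 qe gq.
have [m [h hP]] := torsion_kernel hR hE hC hJ Zfp.
pose d := comp_chom h q.
have [Y [e [Yfp em ed]]] := kernel_fp hR hE hC d (Jn_inj n).1 (Jn_inj m).1.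
have [X x|a aE] := @lift_mono _ _ _ _ e g em.
  by apply/ed; rewrite /= (proj2 (gq X (g X x))) ?chom0 //; exists x.
exists Y, a; split.
- split=> //.
  pose W (n : nat) (a : arrow C) := [/\ injective_fp (src a), injective_fp (tgt a) &
    n = 0%N -> in_add J (src a) /\ in_add J (tgt a)].
  have step k f : W k f ->
      exists (B : cmodule C) (d : chom (tgt f) B), W k.+1 (Arrow d) /\ exact_at (arr f) d.
    case: f => A B f [/= Ainj Binj _].
    have [K [p [pe fp]]] := cokernel_exists f.
    have Kfp := fp_cokernel hadd Ainj.1 Binj.1 pe fp.
    have [M [i [Minj im]]] := enough_injectives hR hE hC Kfp.
    exists M, (comp_chom i p); split=> // X y; rewrite -fp /=.
    by split=> [iy|->]; [apply: im; rewrite iy chom0 | rewrite chom0].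
  have W0 : W 0%N (Arrow d) by split=> //= _; split; exact: in_add_cpower.
  have [Q' [e' [d' [em' ed' dd' W']]]] := coresolution_exists step W0 em ed.
  exists Q', e', d'; split=> // i; first by case: (W' i).
  by case: i => [|[|]] // _; have [_ _ /(_ erefl)[]] := W' 0%N.
- by move=> X x ax; apply/gP; rewrite -aE ax chom0.
move=> D hD y; have /gq[x gx] : q D (e D y) = 0.
  by apply: (torsion_addc hD); apply/hP/(proj2 (ed D (e D y))); exists y.
by exists x; apply: em; rewrite aE.
Qed.

(** Let [L] be the kernel of [Hom(D,-) -> Hom(X,-)] and [L -> Y] its torsion
    closure, with coresolution [Q] in add(J).  An extension [x] of [L -> Q_0] to
    [Hom(D,-)] has a boundary that vanishes on [L], hence extends to an element
    [y1] of [Q_1(X)]; its boundary is torsion, so zero, and [y1] is the boundary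
    of some [y0].  The corrected extension [x - alpha y0] lands in [Y], which
    agrees with [L] over [D].  This gives an endomorphism [q] of [D] that fixes
    [L(c)] and lies in [L(D)], and [sigma = id - q]. *)
Lemma retraction_exists (X D : C) (alpha : mor X D) :
  (forall Y, II J (Some 1%N) Y -> II J None Y) ->
  in_addc c D ->
  (forall Z (f : mor X Z), f \in I X Z -> exists k : mor D Z, f = mcomp k alpha) ->
  (forall Z (f : mor D Z), mcomp f alpha = 0 -> exists2 s : seq (mor D c * mor c Z),
     all (fun t => mcomp t.1 alpha == 0) s & f = \sum_(t <- s) mcomp t.2 t.1) ->
  exists2 sigma : mor D D, mcomp sigma alpha = alpha &
    forall Z (f : mor D Z), mcomp f alpha = 0 -> mcomp f sigma = 0.
Proof.
move=> hII hD afac agen.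
have [L [k [Lfp km ka]]] := kernel_fp hR hE hC (yoneda_map alpha) (fp_yoneda D) (fp_yoneda X).
have [G [p [i [Gfp pe im ip]]]] :=
  image_fp hR hE hC (yoneda_map alpha) (fp_yoneda D) (fp_yoneda X).
have {ip} ip Z (h : mor D Z) : i Z (p Z h) = mcomp h alpha by exact: ip.
have [Y [a [/hII[Yfp [Q [e [d [em ed dd Qinj Qadd]]]]] ator asurj]]] := torsion_closure Lfp.
have [g gE] := (Qinj 0%N).2 _ _ _ (comp_chom e a) Lfp (fp_yoneda D) km.
pose x := g D (idm D); have gx Z (h : mor D Z) : g Z h = mact h x by exact: yoneda_chomE.
pose b := elt_chom (d 0%N D x).
have [Z h ph|r rp] := @factor_epi _ _ _ _ p b pe.
  have /(ka Z h)[l <-] : mcomp h alpha = 0 by rewrite -ip ph chom0.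
  rewrite /= -capp_nat -gx; have -> : g Z (k Z l) = e Z (a Z l) by exact: gE.
  by apply/ed; exists (a Z l).
have [s sE] := (Qinj 1%N).2 _ _ _ r Gfp (fp_yoneda X) im.
(* the boundary of [x], extended from [I(X,-)] to [Hom(X,-)] *)
pose y1 := s X (idm X).
have ay1 : mact alpha y1 = d 0%N D x.
  rewrite -yoneda_chomE -[alpha]comp1m -ip; have -> : s D (i D (p D (idm D))) = r D (p D (idm D)).
    exact: sE.
  by rewrite rp /= mact1.
have /dd[y0 y0E] : d 1%N X y1 = 0.
  apply: (in_add_tf (Qadd 2%N isT)) => h; have [k' ->] := afac _ h (mem_trace_to h).
  rewrite -capp_nat mact_comp ay1 capp_nat (proj2 (dd 0%N _ _)) ?mact0r //.
  by exists x.
have /ed[y yE] : d 0%N D (x - mact alpha y0) = 0.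
  by rewrite chomB capp_nat y0E ay1 subrr.
have [l lE] := asurj D hD y.
have kl0 : mcomp (k D l) alpha = 0 by apply/ka; exists l.
exists (idm D - k D l); first by rewrite compBl comp1m kl0 subr0.
move=> Z f /agen[t /allP t0 ->]; rewrite comp_suml big_seq big1 // => u /t0/eqP u0.
rewrite -mcompA; suff -> : mcomp u.1 (idm D - k D l) = 0 by rewrite compm0.
have /(ka c u.1)[l' l'E] := u0.
suff ll' : mact u.1 l = l'.
  by rewrite compBr compm1 -{1}l'E -ll' capp_nat subrr.
apply/eqP; rewrite -subr_eq0; apply/eqP/torsion_at_c/ator/em.
rewrite chom0 !chomB capp_nat capp_nat lE yE mactB -[mact u.1 (mact _ _)]mact_comp u0 mact0l subr0.
rewrite -gx -l'E; have -> : g c (k c l') = e c (a c l') by exact: gE.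
exact: subrr.
Qed.

End AddJ.

(** * The right adjoint of restriction along C -> C/I *)

Lemma iso_of_bijective (C : precat) (M N : cmodule C) (f : chom M N) :
  cmono f -> cepi f -> is_iso f.
Proof.
move=> fm fe; pose id_ : chom N N :=
  @Chom C _ _ (fun _ x => x) (fun _ _ _ => erefl) (fun _ _ _ _ => erefl).
have [g gP] := lift_mono (g := id_) fm fe.
by exists g; split=> [X x|X y]; [apply: fm|]; rewrite gP.
Qed.

Lemma iso_mono (C : precat) (M N : cmodule C) (f : chom M N) : is_iso f -> cmono f.
Proof. by move=> [g [gK _]] X; apply: can_inj (g X) _. Qed.

Lemma iso_epi (C : precat) (M N : cmodule C) (f : chom M N) : is_iso f -> cepi f.
Proof. by move=> [g [_ fK]] X y; exists (g X y). Qed.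

Section Killed.
Variables (C : precat) (I : cideal C).
Implicit Types M N : cmodule C.
Implicit Types F G : cmodule (quot_cat I).

Definition killed M (X : C) (x : M X) : Prop :=
  forall Y (f : mor X Y), f \in I X Y -> mact f x = 0.

Lemma killed_csub M : is_csub (@killed M).
Proof.
split=> [X Y f _|X x y xk yk Y f fI|X Y g x xk Z f fI].
- exact: mact0r.
- by rewrite mactB xk ?yk ?subrr.
- by rewrite -mact_comp xk //; exact: imem_r.
Qed.

Lemma killed_chom M N (h : chom M N) (X : C) (x : M X) : killed x -> killed (h X x).
Proof. by move=> xk Y f fI; rewrite -capp_nat xk // chom0. Qed.

Lemma qpi_eq0 (X Y : C) (f : mor X Y) : f \in I X Y -> qpi I f = 0.
Proof.
move=> fI; have <- : qpi I (0 : mor X Y) = 0 by exact: raddf0.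
by apply: quot_eq; rewrite subr0.
Qed.

Lemma killed_pi_star F (X : C) (x : pi_star F X) : killed x.
Proof. by move=> Y f fI /=; rewrite qpi_eq0 //; exact: (@mact0l (quot_cat I)). Qed.

Definition rho_sub M : submodule M := csub_of (killed_csub M).

Lemma rho_subP M (X : C) (x : M X) : reflect (killed x) (x \in rho_sub M X).
Proof. exact: (csub_ofP (killed_csub M)). Qed.

Definition rho_act M (X Y : quot_cat I) (f : mor X Y) (x : sub_module (rho_sub M) X) :
  sub_module (rho_sub M) Y := mact (repr (f : Quotient.quot (I X Y))) x.

Lemma rho_act_pi M (X Y : C) (f : mor X Y) (x : sub_module (rho_sub M) X) :
  @rho_act M X Y (qpi I f) x = mact f x.
Proof.
apply: val_inj; apply/eqP; rewrite -subr_eq0 /= -mactBl; apply/eqP.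
by apply: (elimT (rho_subP (val x)) (valP x)); exact: repr_pi_sub.
Qed.

(** The right adjoint of restriction along C -> C/I. *)
Program Definition rho M : cmodule (quot_cat I) :=
  @Cmodule (quot_cat I) (fun X => sub_module (rho_sub M) X) (@rho_act M) _ _ _ _.
Next Obligation. by move=> M X Y f x y; exact: mactDr. Qed.
Next Obligation.
move=> M X Y; elim/quotW=> f; elim/quotW=> g x.
by rewrite -!/(qpi I _) -qpiD !rho_act_pi mactDl.
Qed.
Next Obligation. by move=> M X x; rewrite /= rho_act_pi mact1. Qed.
Next Obligation.
move=> M X Y Z; elim/quotW=> g; elim/quotW=> f x.
by rewrite -!/(qpi I _) /= qcomp_pi !rho_act_pi mact_comp.
Qed.

Program Definition counit M : chom (pi_star (rho M)) M :=
  @Chom C _ _ (fun X x => val x) _ _.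
Next Obligation. by []. Qed.
Next Obligation.
by move=> M X Y f x; have := congr1 (fun z : sub_module (rho_sub M) Y => val z) (rho_act_pi f x).
Qed.

Program Definition transpose F M (h : chom (pi_star F) M) : chom F (rho M) :=
  @Chom (quot_cat I) _ _
    (fun X x => exist _ (h X x) (introT (rho_subP _) (killed_chom h (@killed_pi_star F X x)))) _ _.
Next Obligation. by move=> F M h X x y; apply: val_inj; exact: (@cappD C _ _ h). Qed.
Next Obligation.
move=> F M h X Y; elim/quotW=> f x; rewrite -!/(qpi I _) /= rho_act_pi.
by apply: val_inj; exact: (@capp_nat C _ _ h).
Qed.

Definition rho_map M N (h : chom M N) : chom (rho M) (rho N) :=
  transpose (comp_chom h (counit M)).

Lemma counit_iso M : (forall X (x : M X), killed x) -> is_iso (counit M).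
Proof.
move=> Mk; apply: iso_of_bijective => X => [x y /val_inj //|x].
by exists (exist _ x (introT (rho_subP x) (Mk X x))).
Qed.

End Killed.

(** * Vanishing of classes in Ext^2 *)

Section ZeroClass.
Variables (C : precat) (X D : C) (alpha : mor X D) (A B : cmodule C) (a : A X).
Hypotheses (alpha_a : mact alpha a = 0) (B_D : forall b : B D, b = 0).

(** Comparison of a 2-extension with the start Hom(D,-) -> Hom(X,-) -> A of a
    projective resolution: [e1] and [e2] are the images of the identities. *)
Definition lifting (v : yext 2 A B) (e1 : yterm v 1 X) (e2 : yterm v 2 D) : Prop :=
  ytop v X (ydiff v 0 X e1) = a /\ ydiff v 1 D e2 = mact alpha e1.

Definition zero_class (v : yext 2 A B) : Prop :=
  exists e1 e2, @lifting v e1 e2 /\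
    forall Y (f : mor D Y), mcomp f alpha = 0 -> mact f e2 = 0.

Lemma lifting_exists v : exists e1 e2, @lifting v e1 e2.
Proof.
have [x xa] := iso_epi (ytop_iso v) a.
have [e1 e1x] := @ydiff_epi _ _ _ _ v X x.
have /(@ydiff_exact _ _ _ _ v 0 isT)[e2 e2E] : ydiff v 0 D (mact alpha e1) = 0.
  apply: (iso_mono (ytop_iso v)); rewrite chom0 capp_nat capp_nat e1x xa.
  exact: alpha_a.
by exists e1, e2; split=> //; rewrite e1x.
Qed.

Lemma lifting_unique v e1 e2 e1' e2' Y (f : mor D Y) :
  @lifting v e1 e2 -> @lifting v e1' e2' -> mcomp f alpha = 0 ->
  mact f e2 = mact f e2'.
Proof.
move=> [ae de] [ae' de'] fa.
have /(@ydiff_exact _ _ _ _ v 0 isT)[z zE] : ydiff v 0 X (e1 - e1') = 0.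
  by apply: (iso_mono (ytop_iso v)); rewrite !chomB ae ae' subrr chom0.
have /(@ydiff_exact _ _ _ _ v 1 isT)[b bE] : ydiff v 1 D (e2 - e2' - mact alpha z) = 0.
  by rewrite !chomB de de' capp_nat zE mactB subrr.
have [b' b'E] := iso_epi (ybot_iso v) b.
move: bE; rewrite -b'E (B_D b') !chom0 => /esym/eqP; rewrite subr_eq0 => /eqP e.
apply/eqP; rewrite -subr_eq0 -mactB e -mact_comp fa; apply/eqP; exact: mact0l.
Qed.

(** The comparison map from [L] to [B] determined by a lifting is compatible with
    morphisms of extensions, which are isomorphisms on [B]. *)
Lemma zero_class_mor u v : yext_mor u v -> zero_class u <-> zero_class v.
Proof.
move=> [phi [phid0 phit0 phib0]].
have phid i (hi : (i <= 2)%N) Y x : ydiff v i Y (phi i.+1 Y x) = phi i Y (ydiff u i Y x).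
  exact/esym/phid0.
have phit Y x : ytop v Y (phi 0%N Y x) = ytop u Y x by exact: phit0.
have phib Y b : phi 3 Y (ybot u Y b) = ybot v Y b by exact: phib0.
have lift e1 e2 : @lifting u e1 e2 -> @lifting v (phi 1%N X e1) (phi 2%N D e2).
  move=> [ae de]; split; first by rewrite (phid 0%N isT) phit.
  by rewrite (phid 1%N isT) de capp_nat.
split=> [[e1 [e2 [le e0]]]|[e1' [e2' [le' e0']]]].
  exists (phi 1%N X e1), (phi 2%N D e2); split; first exact: lift.
  by move=> Y f fa; rewrite -capp_nat e0 // chom0.
have [e1 [e2 le]] := lifting_exists u; exists e1, e2; split=> // Y f fa.
have /(@ydiff_exact _ _ _ _ u 1 isT)[b bE] : ydiff u 1 Y (mact f e2) = 0.
  by rewrite capp_nat le.2 -mact_comp fa mact0l.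
have [b' b'E] := iso_epi (ybot_iso u) b.
rewrite -bE; suff -> : b = 0 by exact: chom0.
rewrite -b'E; suff -> : b' = 0 by exact: chom0.
apply: (iso_mono (ybot_iso v)); rewrite -phib b'E.
apply: (@ydiff_mono _ _ _ _ v); rewrite (phid 2%N isT) bE !chom0.
by rewrite capp_nat (lifting_unique (lift _ _ le) le' fa) e0'.
Qed.

Lemma zero_class_eq u v : yext_eq u v -> zero_class u <-> zero_class v.
Proof.
elim=> {u v} [u v /zero_class_mor //|u|u v _ ->|u v w _ -> _ ->] //.
Qed.

End ZeroClass.

Section Generation.
Variables (C : precat) (c : C).
Notation I := (trace_ideal (yoneda c)).

Hypothesis idem2 : k_idempotent I 2.

Variables (X D : C) (alpha : mor X D).
Hypotheses (hD : in_addc c D) (alphaI : alpha \in I X D).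
Hypothesis alpha_fac :
  forall Y (f : mor X Y), f \in I X Y -> exists k : mor D Y, f = mcomp k alpha.

(** The submodule of [Hom(D,-)] generated by the kernel [L(c)] of composition with
    [alpha]. *)
Definition generated (Y : C) (f : mor D Y) : Prop :=
  exists2 s : seq (mor D c * mor c Y),
    all (fun t => mcomp t.1 alpha == 0) s & f = \sum_(t <- s) mcomp t.2 t.1.

Lemma generated_csub : @is_csub C (yoneda D) generated.
Proof.
split=> [Y|Y _ _ [s hs ->] [t ht ->]|Y Z g _ [s hs ->]].
- by exists [::] => //; rewrite big_nil.
- exists (s ++ [seq (u.1, - u.2) | u <- t]).
    by rewrite all_cat hs all_map.
  rewrite big_cat big_map -sumrN; congr (_ + _); apply: eq_bigr => u _.
  by apply: (addIr (mcomp u.2 u.1)); rewrite -compDl !addNr comp0m.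
- exists [seq (u.1, mcomp g u.2) | u <- s]; first by rewrite all_map.
  rewrite big_map [LHS]comp_sumr; apply: eq_bigr => u _; exact: mcompA.
Qed.

Lemma generated_comp0 Y (f : mor D Y) : generated f -> mcomp f alpha = 0.
Proof.
move=> [s /allP hs ->]; rewrite comp_suml big_seq big1 // => t /hs/eqP t0.
by rewrite -mcompA t0 compm0.
Qed.

Program Definition qpi_chom : chom (yoneda X) (pi_star (@yoneda (quot_cat I) X)) :=
  @Chom C _ _ (fun Y f => qpi I f) _ _.
Next Obligation. by move=> Y f g; exact: qpiD. Qed.
Next Obligation. by move=> Y Z g f /=; rewrite qcomp_pi. Qed.

(** Otherwise the quotient of the kernel [L] by its part [T] generated by [L(c)] is
    a nonzero C/I-module, and the evident 2-extension of [Hom(X,-)/I(X,-)] by it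
    has comparison map [L -> L/T].  By 2-idempotence it is equivalent to an
    extension over C/I, where [Hom(X,-)/I(X,-)] is projective, so that the class
    is zero. *)
Lemma kernel_generated Y (f : mor D Y) : mcomp f alpha = 0 -> generated f.
Proof.
pose T := csub_of generated_csub.
have TP Z (g : mor D Z) : quot_proj T Z g = 0 <-> generated g.
  by rewrite quot_projP; split=> [/(csub_ofP generated_csub)|h] //; apply/(csub_ofP generated_csub).
have [Z g /TP/generated_comp0 //|d1 d1E] :=
  factor_epi (g := yoneda_map alpha) (@quot_proj_epi _ _ T).
pose K := csub_of (is_csub_ker d1).
pose B := sub_module K.
have Bk Z (x : B Z) : killed I x.
  case: x => x xK W g gI; apply: val_inj; rewrite -[LHS]/(mact g x).
  have /(csub_ofP (is_csub_ker d1)) := xK.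
  have [h <-] := @quot_proj_epi _ _ T Z x; rewrite d1E => ha.
  rewrite -capp_nat; apply/TP; have /traceP[s gE] := gI.
  exists [seq (mcomp t.1 h, t.2) | t : mor Z c * mor c W <- s].
    rewrite all_map; apply/allP=> t _ /=; apply/eqP.
    by rewrite -mcompA; have -> : mcomp h alpha = 0 by []; rewrite compm0.
  rewrite big_map gE [LHS]comp_suml; apply: eq_bigr => t _; exact/esym/mcompA.
pose F := @yoneda (quot_cat I) X.
pose t i := match i with 0 => pi_star F | 1 => yoneda X | 2 => quot_module T | _ => B end.
pose idc M := @Chom C M M (fun _ x => x) (fun _ _ _ => erefl) (fun _ _ _ _ => erefl).
pose d i : chom (t i.+1) (t i) := match i with
  | 0 => qpi_chom | 1 => d1 | 2 => sub_incl K | _ => idc B end.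
have tiso : is_iso (idc (pi_star F)) by exists (idc _).
have depi : cepi (d 0%N) by move=> Z; elim/quotW=> g; exists g.
have dex i : (i < 2)%N -> exact_at (d i.+1) (d i).
  case: i => [|[|//]] _ Z y; split.
  - move=> y0; have [k ->] : exists k, y = mcomp k alpha.
      apply: alpha_fac; move/eqP: y0; rewrite -(raddf0 (\pi_(Quotient.quot (I X Z)))).
      by rewrite -Quotient.idealrBE subr0.
    by exists (quot_proj T Z k); exact: d1E.
  - move=> [x <-]; have [k <-] := @quot_proj_epi _ _ T Z x.
    have -> : d 1%N Z (quot_proj T Z k) = mcomp k alpha by exact: d1E.
    exact: (qpi_eq0 (imem_l k alphaI)).
  - by move=> y0; exists (exist _ y (introT (csub_ofP (is_csub_ker d1) y) y0)).
  - by move=> [[x xK] <-]; exact/(csub_ofP (is_csub_ker d1)).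
pose u : yext 2 (pi_star F) (pi_star (rho I B)) :=
  @Yext C 2 _ _ t d (idc _) (counit I B) tiso (counit_iso Bk) depi (@sub_incl_mono _ _ K) dex.
have [_ /(_ u)[s su]] := idem2 F (rho I B) (isT : (2 <= 2)%N).
pose a : pi_star F X := qpi I (idm X).
have aa : mact alpha a = 0 by exact: killed_pi_star.
have B_D (b : pi_star (rho I B) D) : b = 0.
  by rewrite -[b]mact1; apply: killed_pi_star.
have : zero_class alpha a u.
  apply/(zero_class_eq aa B_D su).
  have [x xa] := iso_epi (ytop_iso s) (a : F X).
  have [e1 e1x] := @ydiff_epi _ _ _ _ s X x.
  exists e1, 0; split; first split; first by rewrite -xa -e1x.
    by rewrite chom0; apply/esym; exact: (@killed_pi_star C I (yterm s 1) X e1 D alpha alphaI).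
  by move=> Z f' _; exact: mact0r.
move=> [e1 [e2 [le e0]]] fa.
have le' : lifting alpha a (v := u) (idm X : yoneda X X) (quot_proj T D (idm D)).
  split=> //=; rewrite d1E /=.
  by rewrite comp1m compm1.
have := e0 Y f fa; rewrite (lifting_unique B_D le le' fa) -capp_nat => /TP.
by rewrite [mact _ _]compm1.
Qed.

End Generation.

(** * Extensions over C/I and over C *)

Section RhoExtension.
Variables (C : precat) (I : cideal C) (F G : cmodule (quot_cat I)).

Lemma ext0_pi_iso : ext_pi_iso 0 F G.
Proof.
split=> [f g fg X x|h]; first exact: fg.
have hnat X Y (f : @mor (quot_cat I) X Y) (x : F X) : h Y (mact f x) = mact f (h X x) :> G Y.
  by elim/quotW: f => f; exact: (@capp_nat C _ _ h X Y f x).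
by exists (@Chom (quot_cat I) F G (fun X x => h X x) (fun X x y => @cappD C _ _ h X x y) hnat).
Qed.

Section Construction.
Variables (n : nat) (v : yext n (pi_star F) (pi_star G)).

(** The conditions under which [rho] takes the extension [v] to an extension. *)
Definition rho_exact : Prop :=
  (forall X (a : yterm v 0 X), exists2 x, killed I x & ydiff v 0 X x = a) /\
  (forall i, (i < n)%N -> forall X (x : yterm v i.+1 X), killed I x -> ydiff v i X x = 0 ->
     exists2 y, killed I y & ydiff v i.+1 X y = x).

Hypothesis hv : rho_exact.

Let rterm i := rho I (yterm v i).
Let rdiff i : chom (rterm i.+1) (rterm i) := rho_map I (ydiff v i).

Program Definition rtop : chom (rterm 0) F :=
  @Chom (quot_cat I) _ _ (fun X x => ytop v X (val x)) _ _.
Next Obligation. by move=> X x y /=; exact: (@cappD _ _ _ (ytop v)). Qed.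
Next Obligation.
move=> X Y; elim/quotW=> f x; rewrite -!/(qpi I _).
rewrite -[RHS]/(@mact C (pi_star F) X Y f (ytop v X (val x))) -capp_nat.
congr (ytop v Y _).
by have := congr1 (fun z : sub_module (rho_sub I _) Y => val z) (rho_act_pi f x).
Qed.

Lemma rtop_iso : is_iso rtop.
Proof.
apply: iso_of_bijective => X => [x y xy|y].
  by apply: val_inj; exact: (iso_mono (ytop_iso v) xy).
have [g [gK fK]] := ytop_iso v.
have gk : killed I (g X y) by apply: killed_chom; exact: killed_pi_star.
by exists (exist _ (g X y) (introT (rho_subP I _) gk)); exact: fK.
Qed.

Lemma rbot_iso : is_iso (transpose (ybot v) : chom G (rterm n.+1)).
Proof.
apply: iso_of_bijective => X => [x y xy|[x xk]].
  apply: (iso_mono (ybot_iso v)).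
  by have := congr1 (fun z : sub_module (rho_sub I _) X => val z) xy.
have [y yx] := iso_epi (ybot_iso v) x.
by exists y; apply: val_inj.
Qed.

Lemma rdiff_epi : cepi (rdiff 0).
Proof.
move=> X [a ak]; have [x xk xa] := hv.1 X a.
by exists (exist _ x (introT (rho_subP I _) xk)); apply: val_inj.
Qed.

Lemma rdiff_mono : cmono (rdiff n).
Proof.
move=> X x y xy; apply: val_inj; apply: (@ydiff_mono _ _ _ _ v).
by have := congr1 (fun z : sub_module (rho_sub I _) X => val z) xy.
Qed.

Lemma rdiff_exact i : (i < n)%N -> exact_at (rdiff i.+1) (rdiff i).
Proof.
move=> hi X [x xk]; split=> [x0|[y yx]].
  have [||y yk yx] := hv.2 i hi X x.
  - exact/(rho_subP I).
  - by have := congr1 (fun z : sub_module (rho_sub I _) X => val z) x0.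
  by exists (exist _ y (introT (rho_subP I _) yk)); apply: val_inj.
have /= yx' := congr1 (fun z : sub_module (rho_sub I _) X => val z) yx.
by apply: val_inj; apply/(@ydiff_exact _ _ _ _ v i hi); exists (val y).
Qed.

Definition rho_yext : yext n F G :=
  @Yext (quot_cat I) n F G rterm rdiff rtop (transpose (ybot v)) rtop_iso rbot_iso
    rdiff_epi rdiff_mono rdiff_exact.

Lemma rho_yext_counit : yext_mor (pi_star_yext rho_yext) v.
Proof. by exists (fun i => counit I (yterm v i)). Qed.

Lemma rho_yext_transpose (s : yext n F G) :
  yext_mor (pi_star_yext s) v -> yext_mor s rho_yext.
Proof.
move=> [phi [phid phit phib]]; exists (fun i => transpose (phi i)); split.
- by move=> i hi X x; apply: val_inj; exact: phid.
- by move=> X x; exact: phit.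
- by move=> X x; apply: val_inj; exact: phib.
Qed.

End Construction.

Lemma yext_mor_comp (C' : precat) (A B : cmodule C') n (u v w : yext n A B) :
  yext_mor u v -> yext_mor v w -> yext_mor u w.
Proof.
move=> [f [fd ft fb]] [g [gd gt gb]]; exists (fun i => comp_chom (g i) (f i)); split.
- by move=> i hi X x; exact: etrans (congr1 (g i X) (fd i hi X x)) (gd i hi X _).
- by move=> X x; exact: etrans (gt X _) (ft X x).
- by move=> X x; exact: etrans (congr1 (g n.+1 X) (fb X x)) (gb X x).
Qed.

(** The extension [rho (Phi u)] depends functorially on [u], so it is well defined
    on classes; unit and counit of the adjunction make it inverse to
    restriction. *)
Lemma ext_iso_of_replacement n
    (Phi : yext n.+1 (pi_star F) (pi_star G) -> yext n.+1 (pi_star F) (pi_star G)) :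
  (forall u, rho_exact (Phi u)) -> (forall u, yext_mor u (Phi u)) ->
  (forall u v, yext_mor u v -> yext_mor (Phi u) (Phi v)) ->
  ext_pi_iso n.+1 F G.
Proof.
move=> ex unit_ fun_; pose Psi u := rho_yext (ex u); split.
  have PsiE u v : yext_eq u v -> yext_eq (Psi u) (Psi v).
    elim=> {u v} [u v uv|u|u v _ uv|u v w _ uv _ vw].
    - apply: rst_step; apply: rho_yext_transpose.
      exact: yext_mor_comp (rho_yext_counit _) (fun_ _ _ uv).
    - exact: rst_refl.
    - exact: rst_sym.
    - exact: rst_trans vw.
  have PsiS s : yext_eq s (Psi (pi_star_yext s)).
    by apply: rst_step; apply: rho_yext_transpose; exact: unit_.
  move=> s t st; apply: rst_trans (PsiS s) _.
  apply: rst_trans (PsiE _ _ st) _; apply: rst_sym; exact: PsiS.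
move=> u; exists (Psi u); apply: rst_trans (rst_sym _ _ _ _ (rst_step _ _ _ _ (unit_ u))).
by apply: rst_step; exact: rho_yext_counit.
Qed.

End RhoExtension.

(** * Pushouts and coinduced modules *)

Section Pushout.
Variable C : precat.
Implicit Types M N K Q : cmodule C.

Program Definition prod_module N K : cmodule C :=
  @Cmodule C (fun X => (N X * K X)%type) (fun X Y f x => (mact f x.1, mact f x.2)) _ _ _ _.
Next Obligation. by move=> N K X Y f x y; rewrite /= !mactDr. Qed.
Next Obligation. by move=> N K X Y f g x; rewrite /= !mactDl. Qed.
Next Obligation. by move=> N K X [x y]; rewrite /= !mact1. Qed.
Next Obligation. by move=> N K X Y Z g f x; rewrite /= !mact_comp. Qed.

Section Def.
Variables (M N K : cmodule C) (f : chom M N) (g : chom M K).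

Lemma po_csub : @is_csub C (prod_module N K)
  (fun X x => exists m : M X, x = (f X m, - g X m)).
Proof.
split=> [X|X _ _ [m ->] [m' ->]|X Y h _ [m ->]].
- by exists 0; rewrite !chom0 oppr0.
- by exists (m - m'); rewrite !chomB opprD.
- by exists (mact h m); rewrite /= !capp_nat raddfN.
Qed.

Definition pushout : cmodule C := quot_module (csub_of po_csub).

Definition po : chom (prod_module N K) pushout := quot_proj (csub_of po_csub).

Lemma po_epi : cepi po. Proof. exact: quot_proj_epi. Qed.

Lemma po_eq0 X (n : N X) (k : K X) :
  po X (n, k) = 0 <-> exists m, n = f X m /\ k = - g X m.
Proof.
rewrite quot_projP; split=> [/(csub_ofP po_csub)[m [-> ->]]|[m [-> ->]]].
  by exists m.
by apply/(csub_ofP po_csub); exists m.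
Qed.

Program Definition po_inl : chom N pushout := @Chom C _ _ (fun X n => po X (n, 0)) _ _.
Next Obligation.
move=> X x y; rewrite -cappD; congr (po X _).
by rewrite -[RHS]/(x + y, 0 + 0) addr0.
Qed.
Next Obligation.
by move=> X Y h x; rewrite -capp_nat; congr (po Y _); rewrite /= mact0r.
Qed.

Program Definition po_inr : chom K pushout := @Chom C _ _ (fun X k => po X (0, k)) _ _.
Next Obligation.
move=> X x y; rewrite -cappD; congr (po X _).
by rewrite -[RHS]/(0 + 0, x + y) addr0.
Qed.
Next Obligation.
by move=> X Y h x; rewrite -capp_nat; congr (po Y _); rewrite /= mact0r.
Qed.

Lemma po_shift X (m : M X) (k : K X) : po X (f X m, k) = po_inr X (k + g X m).
Proof.
apply/eqP; rewrite -subr_eq0 -chomB; apply/eqP.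
rewrite -[X in po _ X]/(f X m - 0, k - (k + g X m)).
by apply/po_eq0; exists m; rewrite subr0 opprD addNKr.
Qed.

Lemma po_square X (m : M X) : po_inl X (f X m) = po_inr X (g X m).
Proof. by rewrite [LHS]po_shift add0r. Qed.

Lemma po_desc_exists Q (h : chom (prod_module N K) Q) :
  (forall X m, h X (f X m, - g X m) = 0) ->
  exists h' : chom pushout Q, forall X x, h' X (po X x) = h X x.
Proof.
move=> h0; apply: factor_epi po_epi _ => X [n k] /po_eq0[m [-> ->]].
exact: h0.
Qed.

Definition po_desc Q (h : chom (prod_module N K) Q)
    (h0 : forall X m, h X (f X m, - g X m) = 0) : chom pushout Q :=
  projT1 (cid (po_desc_exists h0)).

Lemma po_descE Q (h : chom (prod_module N K) Q) h0 X x :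
  @po_desc Q h h0 X (po X x) = h X x.
Proof. exact: (projT2 (cid (po_desc_exists h0))). Qed.

End Def.

Program Definition prod_fst N K : chom (prod_module N K) N :=
  @Chom C _ _ (fun X x => x.1) _ _.
Next Obligation. by []. Qed.
Next Obligation. by []. Qed.

Program Definition prod_map N K N' K' (a : chom N N') (b : chom K K') :
  chom (prod_module N K) (prod_module N' K') :=
  @Chom C _ _ (fun X x => (a X x.1, b X x.2)) _ _.
Next Obligation. by move=> *; rewrite /= !cappD. Qed.
Next Obligation. by move=> *; rewrite /= !capp_nat. Qed.

End Pushout.

Section Coinduced.
Variables (R : comPzRingType) (E : lmodType R) (C : lincat R).
Implicit Types M N : cmodule C.

Section Value.
Variables (M : cmodule C) (X : C).

Definition coind_index : Type := {Z : C & (rdual E M Z * lhom X Z)%type}.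

Definition coind_mem : {pred coind_index -> E} := fun k =>
  `[< forall (Z : C) (phi : rdual E M Z),
        linear (fun g : lhom X Z => k (existT _ Z (phi, g))) >].

Lemma coind_mem_closed : zmod_closed coind_mem.
Proof.
split=> [|k l /asboolP kl /asboolP ll]; apply/asboolP=> Z phi a x y /=.
  by rewrite scaler0 addr0.
by rewrite !fctE kl ll scalerBr addrACA opprD.
Qed.

HB.instance Definition _ :=
  GRing.isZmodClosed.Build (coind_index -> E) coind_mem coind_mem_closed.

Definition coind_val : zmodType := sub_zmod coind_mem.

Lemma coind_linear (k : coind_val) (Z : C) (phi : rdual E M Z) :
  linear (fun g : lhom X Z => val k (existT _ Z (phi, g))).
Proof. exact: (asboolW (valP k)). Qed.

End Value.

Program Definition coind_act M (X Y : C) (f : mor X Y) (k : coind_val M X) :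
  coind_val M Y :=
  exist _ (fun i : coind_index M Y =>
    val k (existT _ (projT1 i) ((projT2 i).1, lcomp (projT2 i).2 f))) _.
Next Obligation.
move=> M X Y f k; apply/asboolP=> Z phi a x y /=.
by rewrite lcomp_linl (coind_linear k phi).
Qed.

(** A functorial substitute for the injective envelope: the product, over all
    [Z] and all linear forms on [M Z], of the modules [Hom_R(Hom(-,Z), E)]. *)
Program Definition coind M : cmodule C :=
  @Cmodule C (coind_val M) (@coind_act M) _ _ _ _.
Next Obligation. by move=> *; apply: val_inj; apply/funext. Qed.
Next Obligation.
move=> M X Y f g k; apply: val_inj; apply/funext=> -[Z [phi h]] /=.
rewrite (lcompDr (C := C)).
exact: (linearD_of (@coind_linear M X k Z phi)).
Qed.
Next Obligation.
move=> M X k; apply: val_inj; apply/funext=> -[Z [phi h]] /=.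
by rewrite lcompm1.
Qed.
Next Obligation.
move=> M X Y Z g f k; apply: val_inj; apply/funext=> -[W [phi h]] /=.
by rewrite lcompA.
Qed.

Program Definition coind_unit_val M (X : C) (m : M X) : coind_val M X :=
  exist _ (fun i : coind_index M X =>
    val (projT2 i).1 (@mact C M X (projT1 i) (projT2 i).2 m)) _.
Next Obligation.
move=> M X m; apply/asboolP=> Z phi a g h /=.
rewrite mactDl -(@rdual_linear R E C M Z phi); congr (val phi (_ + _)).
by rewrite rval_scaleE -mact_comp /= lcompZl lcomp1m.
Qed.

Program Definition coind_unit M : chom M (coind M) :=
  @Chom C _ _ (@coind_unit_val M) _ _.
Next Obligation.
move=> M X m m'; apply: val_inj; apply/funext=> -[Z [phi h]] /=.
by rewrite mactDr; exact: (linearD_of (@rdual_linear R E C M Z phi)).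
Qed.
Next Obligation.
move=> M X Y f m; apply: val_inj; apply/funext=> -[Z [phi h]] /=.
by rewrite -mact_comp.
Qed.

Program Definition coind_map_val M N (h : chom M N) (X : C) (k : coind_val M X) :
  coind_val N X :=
  exist _ (fun i : coind_index N X =>
    val k (existT _ (projT1 i) (dual_app h (projT2 i).1, (projT2 i).2))) _.
Next Obligation. by move=> M N h X k; apply/asboolP=> Z phi; exact: (@coind_linear M X k Z (dual_app h phi)). Qed.

Program Definition coind_map M N (h : chom M N) : chom (coind M) (coind N) :=
  @Chom C _ _ (@coind_map_val M N h) _ _.
Next Obligation. by move=> *; apply: val_inj; apply/funext. Qed.
Next Obligation. by move=> *; apply: val_inj; apply/funext. Qed.

Lemma coind_map_unit M N (h : chom M N) X (m : M X) :
  coind_map h X (coind_unit M X m) = coind_unit N X (h X m).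
Proof.
apply: val_inj; apply/funext=> -[Z [phi g]] /=.
by rewrite capp_nat.
Qed.

Hypotheses (hR : artinian R) (hE : injective_envelope_lmod (residue_lmod R) E).

Lemma coind_unit_mono M : cmono (coind_unit M).
Proof.
apply: chom_mono0 => X m m0; apply: (rdual_separates hR hE) => psi.
have := congr1 (fun k : coind_val M X => val k (existT _ X (psi, lidm X))) m0.
by rewrite /= (@mact1 C M).
Qed.

(** Forms on Hom(D,Z) extend along an injection Hom(D,Z) -> Hom(X,Z). *)
Lemma coind_act_surjective M (X D : C) (eps : mor X D) :
  (forall Z (k : mor D Z), mcomp k eps = 0 -> k = 0) ->
  forall y : coind M D, exists x : coind M X, mact eps x = y.
Proof.
move=> einj y.
have ext (Z : C) (phi : rdual E M Z) : exists g : lhom X Z -> E, linear g /\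
    forall k : lhom D Z, g (lcomp k eps) = val y (existT _ Z (phi, k)).
  have [|g hg gE] := injective_extend hE (lcomp_linl eps) _ (@coind_linear M D y Z phi).
    move=> k k' kk'; apply/eqP; rewrite -subr_eq0; apply/eqP/einj.
    by rewrite compBl; apply/eqP; rewrite subr_eq0; apply/eqP; exact: kk'.
  by exists g.
pose x0 (i : coind_index M X) : E := projT1 (cid (ext (projT1 i) (projT2 i).1)) (projT2 i).2.
have x0P : x0 \in @coind_mem M X.
  by apply/asboolP=> Z phi; exact: (projT2 (cid (ext Z phi))).1.
exists (exist _ x0 x0P); apply: val_inj; apply/funext=> -[Z [phi k]] /=.
exact: (projT2 (cid (ext Z phi))).2.
Qed.

End Coinduced.

(** * Replacement of a 2-extension by a pushout *)

Section Replacement.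
Variables (R : comPzRingType) (hR : artinian R) (E : lmodType R)
  (hE : injective_envelope_lmod (residue_lmod R) E) (C : lincat R).

Section OneExtension.
Variables (A B : cmodule C) (u : yext 2 A B).

Let K := coind E (yterm u 2).
Let j : chom (yterm u 2) K := coind_unit E (yterm u 2).
Let Q : cmodule C := pushout (ydiff u 1) j.

Definition push_term (i : nat) : cmodule C :=
  match i with 0 => yterm u 0 | 1 => Q | 2 => K | n.+3 => yterm u n.+3 end.

Lemma push_top_zero X m :
  comp_chom (ydiff u 0) (prod_fst (yterm u 1) K) X (ydiff u 1 X m, - j X m) = 0.
Proof. by apply/(@ydiff_exact _ _ _ _ u 0 isT); exists m. Qed.

Definition push_top : chom Q (yterm u 0) := po_desc push_top_zero.

Lemma push_topE X n k : push_top X (po _ _ X (n, k)) = ydiff u 0 X n.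
Proof. exact: po_descE. Qed.

Definition push_diff (i : nat) : chom (push_term i.+1) (push_term i) :=
  match i with 0 => push_top | 1 => po_inr _ _ | 2 => comp_chom j (ydiff u 2)
  | n.+3 => ydiff u n.+3 end.

Lemma push_diff_epi : cepi (push_diff 0).
Proof.
move=> X a; have [e <-] := @ydiff_epi _ _ _ _ u X a.
by exists (po_inl _ _ X e); exact: push_topE.
Qed.

Lemma push_diff_mono : cmono (push_diff 2).
Proof.
move=> X x y xy; apply: (@ydiff_mono _ _ _ _ u).
exact: (coind_unit_mono hR hE xy).
Qed.

Lemma push_inr_eq0 X (k : K X) :
  po_inr (ydiff u 1) j X k = 0 <-> exists b, j X (ydiff u 2 X b) = k.
Proof.
split=> [/po_eq0[m [/esym m0 ->]]|[b <-]].
  have /(@ydiff_exact _ _ _ _ u 1 isT)[b <-] := m0.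
  by exists (- b); rewrite !chomN.
apply/po_eq0; exists (- ydiff u 2 X b); rewrite !chomN opprK; split=> //.
have -> : ydiff u 1 X (ydiff u 2 X b) = 0; last by rewrite oppr0.
by apply/(@ydiff_exact _ _ _ _ u 1 isT); exists b.
Qed.

Lemma push_top_eq0 X (x : Q X) : push_top X x = 0 -> exists k, po_inr (ydiff u 1) j X k = x.
Proof.
have [[e k] <-] := po_epi x; rewrite push_topE => /(@ydiff_exact _ _ _ _ u 0 isT)[z <-].
by exists (k + j X z); rewrite po_shift.
Qed.

Lemma push_diff_exact i : (i < 2)%N -> exact_at (push_diff i.+1) (push_diff i).
Proof.
case: i => [|[|//]] _ X x; last exact: push_inr_eq0.
split=> [/push_top_eq0 //|[k <-]].
by rewrite [LHS]push_topE chom0.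
Qed.

(** The pushout of [u] along the embedding of its term [yterm u 2] in a coinduced
    module. *)
Definition push_yext : yext 2 A B :=
  @Yext C 2 A B push_term push_diff (ytop u) (ybot u) (ytop_iso u) (ybot_iso u)
    push_diff_epi push_diff_mono push_diff_exact.

Lemma push_unit : yext_mor u push_yext.
Proof.
pose idc M := @Chom C M M (fun _ x => x) (fun _ _ _ => erefl) (fun _ _ _ _ => erefl).
exists (fun i => match i as i return chom (yterm u i) (push_term i) with
  0 => idc _ | 1 => po_inl _ _ | 2 => j | n.+3 => idc _ end); split=> //.
case=> [|[|[|//]]] _ X x //; first exact/esym/push_topE.
exact: po_square.
Qed.

End OneExtension.

Lemma push_functor (A B : cmodule C) (u v : yext 2 A B) :
  yext_mor u v -> yext_mor (push_yext u) (push_yext v).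
Proof.
move=> [f [fd ft fb]].
have f1 X m : comp_chom (po (ydiff v 1) (coind_unit E (yterm v 2)))
    (prod_map (f 1%N) (coind_map E (f 2))) X
    (ydiff u 1 X m, - coind_unit E (yterm u 2) X m) = 0.
  apply/po_eq0; exists (f 2 X m); split; first exact: fd.
  by rewrite chomN coind_map_unit.
exists (fun i => match i as i return chom (yterm (push_yext u) i) (yterm (push_yext v) i) with
  0 => f 0%N | 1 => po_desc f1 | 2 => coind_map E (f 2) | n.+3 => f n.+3 end); split=> //.
case=> [|[|[|//]]] _ X x.
- rewrite /=; have [[e k] <-] := po_epi x; rewrite push_topE po_descE [RHS]push_topE.
  exact: fd.
- by rewrite /= po_descE /= chom0.
- have e2 : f 2 X (ydiff u 2 X x) = ydiff v 2 X (f 3 X x) by exact: fd.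
  rewrite -[RHS]/(coind_unit E (yterm v 2) X (ydiff v 2 X (f 3 X x))) -e2.
  exact: coind_map_unit.
Qed.

End Replacement.

(** * Idempotence from reflections *)

Section StrongIdempotence.
Variables (R : comPzRingType) (C : lincat R) (c : C).

Notation I := (trace_ideal (yoneda c)).

Lemma killed_top (M : cmodule C) (F : cmodule (quot_cat I)) (h : chom M (pi_star F)) :
  is_iso h -> forall X (x : M X), killed I x.
Proof.
move=> [g [gK _]] X x; rewrite -(gK X x); apply: killed_chom; exact: killed_pi_star.
Qed.

Lemma killed_bot (M : cmodule C) (F : cmodule (quot_cat I)) (h : chom (pi_star F) M) :
  is_iso h -> forall X (x : M X), killed I x.
Proof.
move=> hi X x; have [y <-] := iso_epi hi x; apply: killed_chom; exact: killed_pi_star.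
Qed.

Lemma killed_addc (M : cmodule C) (D : C) (x : M D) : in_addc c D -> killed I x -> x = 0.
Proof. by move=> hD xk; rewrite -[x]mact1; exact: xk. Qed.

Lemma killed_reflection (M : cmodule C) (X D : C) (eps : mor X D) (x : M X) :
  reflection c eps -> mact eps x = 0 -> killed I x.
Proof.
move=> [_ _ efac _] ex Y f /efac[k ->].
by rewrite mact_comp ex mact0r.
Qed.

Hypothesis refl : forall X : C, exists (D : C) (eps : mor X D), reflection c eps.

Variables F G : cmodule (quot_cat I).

(** If [I] annihilates [a] then it annihilates each [e] over [a]: the element
    [eps e] comes from [G], which vanishes over [D]. *)
Lemma rho_exact1 (u : yext 1 (pi_star F) (pi_star G)) : rho_exact u.
Proof.
split=> [X a|[|//] _ X x xk /(@ydiff_exact _ _ _ _ u 0 isT)[y yx]].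
  have [e ea] := @ydiff_epi _ _ _ _ u X a; exists e => //.
  have [D [eps epsP]] := refl X; have [hD eI _ _] := epsP.
  apply: (killed_reflection epsP).
  have /(@ydiff_exact _ _ _ _ u 0 isT)[b <-] : ydiff u 0 D (mact eps e) = 0.
    by rewrite capp_nat ea; apply: (killed_top (ytop_iso u)).
  rewrite (killed_addc hD (killed_bot (ybot_iso u) b)); exact: chom0.
by exists y => //; exact: (killed_bot (ybot_iso u)).
Qed.

(** Given [e] over [a], the element [eps e] comes from some [z] in the middle term
    over [D].  The coinduced module has a preimage [k] of [z] under [eps], and
    subtracting it from [e] in the pushout gives a lift annihilated by [I].
    Exactness elsewhere holds because [G] vanishes over [D]. *)
Lemma push_rho_exact (hR : artinian R) (E : lmodType R)
    (hE : injective_envelope_lmod (residue_lmod R) E)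
    (u : yext 2 (pi_star F) (pi_star G)) : rho_exact (push_yext hR hE u).
Proof.
pose j := coind_unit E (yterm u 2); split=> [X a|[|[|//]] _ X x xk].
- have [e ea] := @ydiff_epi _ _ _ _ u X a.
  have [D [eps epsP]] := refl X; have [hD eI _ einj] := epsP.
  have /(@ydiff_exact _ _ _ _ u 0 isT)[z zE] : ydiff u 0 D (mact eps e) = 0.
    by rewrite capp_nat ea; apply: (killed_top (ytop_iso u)).
  have [k kE] := coind_act_surjective hE einj (j D z).
  exists (po (ydiff u 1) j X (e, - k)); last by rewrite [LHS]push_topE.
  apply: (killed_reflection epsP); rewrite -capp_nat; apply/po_eq0; exists z.
  by rewrite zE mactN kE.
- move=> /(@push_top_eq0 R E C _ _ u X x)[k kx]; exists k => //.
  have [D [eps epsP]] := refl X; have [hD eI _ _] := epsP.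
  apply: (killed_reflection epsP).
  have /(@push_inr_eq0 R E C _ _ u)[b <-] : po_inr (ydiff u 1) j D (mact eps k) = 0.
    by rewrite capp_nat kx; exact: xk.
  by rewrite (killed_addc hD (killed_bot (ybot_iso u) b)) !chom0.
move=> /(@push_inr_eq0 R E C _ _ u X x)[b bx]; exists b => //.
exact: (killed_bot (ybot_iso u)).
Qed.

End StrongIdempotence.

Lemma reflective_2_idempotent (R : comPzRingType) (hR : artinian R) (E : lmodType R)
    (hE : injective_envelope_lmod (residue_lmod R) E) (C : lincat R) (c : C) :
  (forall X : C, exists (D : C) (eps : mor X D), reflection c eps) ->
  k_idempotent (trace_ideal (yoneda c)) 2.
Proof.
move=> refl F G [|[|[|//]]] _; first exact: ext0_pi_iso.
  apply: (ext_iso_of_replacement (Phi := id)) => // [u|u]; first exact: rho_exact1.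
  by exists (fun i => @Chom _ _ _ (fun _ x => x) (fun _ _ _ => erefl) (fun _ _ _ _ => erefl)).
apply: (@ext_iso_of_replacement _ _ F G 1
  (@push_yext R hR E hE C (pi_star F) (pi_star G))).
- by move=> u; exact: push_rho_exact.
- exact: push_unit.
- exact: push_functor.
Qed.

Theorem proposition8p12 (R : comPzRingType) (hR : artinian R)
  (E : lmodType R) (hE : injective_envelope_lmod (residue_lmod R) E)
  (C : lincat R) (hC : dualizing_variety E C) (c : C) (J : cmodule C)
  (hJ : injective_envelope_fp (quot_module (cmod_rad (yoneda c))) J) :
  (k_idempotent (trace_ideal (yoneda c)) 2 /\
   forall Y : cmodule C, II J (Some 1%N) Y <-> II J None Y)
  <->
  (forall C' : C, cprojective (ideal_at (trace_ideal (yoneda c)) C')).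
Proof.
split=> [[idem2 hII] X|Iproj].
  have [D [alpha [hD aI afac]]] := approximation hC.1 c X.
  have [||sigma sa s0] := retraction_exists hR hE hC hJ _ hD afac.
  - by move=> Y /hII.
  - by move=> Z f; exact: (kernel_generated idem2 hD aI afac).
  exact: projective_of_retraction aI afac sa s0.
have refl X := reflection_exists hC.1 (Iproj X).
split; first exact: (reflective_2_idempotent hR hE).
move=> Y; split; first exact: (II_one_infinite hR hE hC hJ Iproj).
move=> [Yfp [Q [e [d [em ed dd Qinj Qadd]]]]]; split=> //.
by exists Q, e, d; split=> // i _; exact: Qadd.
Qed.
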